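(* Let $n\ge2$ and $m\ge 2$ be integers, let $\Gamma$ be a discrete additive subgroup of $\mathbb{R}^l$ and $\mathbb{G}$ a finite isometric group on $\Gamma$. Let $g_1,\dots,g_m\in\mathbb{G}$, $b_1,\dots,b_m\in\Gamma$, and let $E=\bigcup_{i=1}^m\left(\frac{g_iE}{n}+b_i\right)$ be the self-similar set in $\mathbb{R}^l$ generated by the similitudes $S_i(x)=g_i(x)/n+b_i$. Suppose that $E$ is totally disconnected and has no complete overlaps. Then $E\in\mathfrak{A}^{1/n}$ with characteristic $m$ (that is, $E\in\mathfrak{A}_m^{1/n}$), and thus $E$ is bilipschitz equivalent to $\Sigma_m^{1/n}$.
   Context: Finite isometric group on $\Gamma$: a finite group $\mathbb{G}$ (under composition) of maps $g:\Gamma\to\Gamma$ with $g(0)=0$ and $|g(a_1)-g(a_2)|=|a_1-a_2|$ for all $a_1,a_2\in\Gamma$; this implies that $g$ can be extended to a linear isometry of $\mathbb{R}^l$, which is again denoted $g$. The self-similar set generated by contracting similitudes $S_1,\dots,S_m$ is the unique nonempty compact set $E$ with $E=\bigcup_iS_i(E)$. It has complete overlaps if there are two distinct finite sequences $i_1\cdots i_t$ and $j_1\cdots j_{t'}$ of indices with $S_{i_1}\circ\cdots\circ S_{i_t}\equiv S_{j_1}\circ\cdots\circ S_{j_{t'}}$. Graph-directed sets: let $r\in(0,1)$, and let $G$ be a finite directed graph (multiple edges and loops allowed) with vertices $\{1,\dots,p\}$, each having at least one outgoing edge; let $\mathcal{E}_{i,j}$ be the set of edges from $i$ to $j$, and let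 $A=(a_{i,j})$ with $a_{i,j}=\#\mathcal{E}_{i,j}$ be the adjacency matrix. Let $(X,\mathrm{d})$ be a compact metric space and, for each edge $e$, let $S_e:X\to X$ satisfy $\mathrm{d}(S_ex,S_ey)=r\,\mathrm{d}(x,y)$ for all $x,y\in X$. There is a unique family $\{K_1,\dots,K_p\}$ of nonempty compact subsets of $X$ with $K_i=\bigcup_{j}\bigcup_{e\in\mathcal{E}_{i,j}}S_e(K_j)$ for every $i$; these are the graph-directed sets with ratio $r$. They are dust-like if for every $i$ this union is disjoint. They have integer characteristic $m$ (an integer $m\ge2$) if there is a vector $v\in\mathbb{R}^p$ with all entries positive and $Av=mv$. $\mathfrak{A}_m^r$ is the class of all $K$ such that $K=K_1$ for some dust-like graph-directed sets $\{K_i\}_i$ with ratio $r$ and integer characteristic $m$; $\mathfrak{A}^r=\bigcup_{m\ge2}\mathfrak{A}_m^r$. $\Sigma_m^r=\{1,\dots,m\}^{\infty}$ with metric $d(x_0x_1\cdots,y_0y_1\cdots)=r^{\min\{k:\,x_k\ne y_k\}}$ for distinct sequences. Two metric spaces are bilipschitz equivalent if there is a bijection $f$ between them and a constant $C>0$ with $C^{-1}\mathrm{d}(x,y)\le\mathrm{d}'(f(x),f(y))\le C\,\mathrm{d}(x,y)$ for all $x,y$.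
   Formalization: The extensions of the elements of 𝔾 to linear isometries of ℝ^l are assumed compatible with composition; this is automatic if Γ spans ℝ^l, and with arbitrary extensions for non-spanning Γ the claim fails (E={0} with free rotations on the complement). *)

(* Defs.v *)
From HB Require Import structures.
From mathcomp Require Import all_boot all_order all_algebra.
From mathcomp Require Import all_classical all_reals all_analysis.

Set Implicit Arguments.
Unset Strict Implicit.
Unset Printing Implicit Defensive.

Import Order.TTheory GRing.Theory Num.Theory.
Import numFieldNormedType.Exports.

Local Open Scope classical_set_scope.
Local Open Scope ring_scope.

(* R^l is 'rV[R]_l. Its library norm is the sup norm, hence the explicit      *)
(* Euclidean norm below; its library topology is the product topology, which  *)
(* is the Euclidean one, so compactness, isolated points and total            *)
(* disconnectedness are the library notions.                                  *)
Definition eucl_norm (R : realType) (l : nat) (x : 'rV[R]_l) : R :=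
  Num.sqrt (\sum_(i < l) x ord0 i ^+ 2).

Definition eucl_dist (R : realType) (l : nat) (x y : 'rV[R]_l) : R :=
  eucl_norm (x - y).

Definition subset_dist (R : realType) (l : nat) (E : set 'rV[R]_l) (x y : E) : R :=
  eucl_dist (\val x) (\val y).

Definition discrete_subgroup (R : realType) (l : nat) (G : set 'rV[R]_l) : Prop :=
  [/\ G 0, (forall a b, G a -> G b -> G (a - b)) & G `<=` isolated G].

Definition finite_isometric_group (R : realType) (l : nat) (G : set 'rV[R]_l)
    (GG : set (G -> G)) : Prop :=
  [/\ finite_set GG,
      [/\ GG id,
          (forall g h, GG g -> GG h -> GG (g \o h)) &
          (forall g, GG g -> exists h, [/\ GG h, cancel g h & cancel h g])],
      (forall g, GG g -> forall a : G, \val a = 0 -> \val (g a) = 0) &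
      (forall g, GG g -> forall a1 a2 : G,
         eucl_dist (\val (g a1)) (\val (g a2)) =
         eucl_dist (\val a1) (\val a2))].

(* The extension of the elements of GG to linear isometries of R^l. When G    *)
(* spans R^l it exists, is unique and is automatically multiplicative. When G *)
(* does not span, it is not unique (the identity on the orthogonal complement *)
(* of G is one choice), and multiplicativity is what makes the extended maps  *)
(* again a finite group under composition.                                    *)
Definition linear_isometric_extension (R : realType) (l : nat)
    (G : set 'rV[R]_l) (GG : set (G -> G))
    (ext : (G -> G) -> {linear 'rV[R]_l -> 'rV[R]_l}) : Prop :=
  [/\ (forall g, GG g -> forall x, eucl_norm (ext g x) = eucl_norm x),
      (forall g, GG g -> forall a : G, ext g (\val a) = \val (g a)) &
      (forall g h, GG g -> GG h -> ext (g \o h) =1 ext g \o ext h)].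

Definition self_similar_set (T : topologicalType) (m : nat)
    (S : 'I_m -> T -> T) (E : set T) : Prop :=
  [/\ E !=set0, compact E & E = \bigcup_(i in [set: 'I_m]) (S i @` E)].

Definition word_map (T : Type) (m : nat) (S : 'I_m -> T -> T) (w : seq 'I_m) :
  T -> T := foldr (fun i f => S i \o f) id w.

Definition complete_overlaps (T : Type) (m : nat) (S : 'I_m -> T -> T) : Prop :=
  exists w w' : seq 'I_m,
    [/\ w != [::], w' != [::], w != w' & word_map S w =1 word_map S w'].

(* A directed multigraph with vertices 'I_p.+1; vertex ord0 is the            *)
(* distinguished vertex 1.                                                    *)
Record multigraph := Multigraph {
  gsize : nat;
  gedge : finType;
  gsrc : gedge -> 'I_gsize.+1;
  gtgt : gedge -> 'I_gsize.+1;
  gsrc_surj : forall i, exists e, gsrc e = i }.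

Definition adjacency (R : realType) (Q : multigraph) : 'M[R]_((gsize Q).+1) :=
  \matrix_(i, j) #|[set e : gedge Q | (gsrc e == i) && (gtgt e == j)]%SET|%:R.

Definition integer_characteristic (R : realType) (Q : multigraph) (m : nat) :
    Prop :=
  (2 <= m)%N /\
  exists v : 'cV[R]_((gsize Q).+1),
    (forall i, 0 < v i ord0) /\ adjacency R Q *m v = m%:R *: v.

Definition graph_directed_sets (R : realType) (Q : multigraph) (X : metricType R)
    (r : R) (S : gedge Q -> X -> X) (K : 'I_(gsize Q).+1 -> set X) : Prop :=
  [/\ 0 < r < 1,
      compact [set: X],
      (forall e x y, mdist (S e x) (S e y) = r * mdist x y),
      (forall i, K i !=set0 /\ compact (K i)) &
      (forall i, K i = \bigcup_(e in [set e | gsrc e = i]) (S e @` K (gtgt e)))].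

Definition dust_like (Q : multigraph) (X : Type) (S : gedge Q -> X -> X)
    (K : 'I_(gsize Q).+1 -> set X) : Prop :=
  forall i, trivIset [set e | gsrc e = i] (fun e => S e @` K (gtgt e)).

(* Membership of the metric space (T, d) in the class A_m^r. The equality     *)
(* K = K_1 is one of metric spaces: the ambient X is abstract, so T is        *)
(* identified with K_1 by an isometric embedding onto it.                     *)
Definition dust_class (R : realType) (m : nat) (r : R) (T : Type)
    (d : T -> T -> R) : Prop :=
  exists (Q : multigraph) (X : metricType R) (S : gedge Q -> X -> X)
         (K : 'I_(gsize Q).+1 -> set X),
    [/\ graph_directed_sets r S K, dust_like S K, integer_characteristic R Q m &
        exists phi : T -> X,
          (forall x y, mdist (phi x) (phi y) = d x y) /\ range phi = K ord0].

Definition symbolic_dist (R : realType) (m : nat) (r : R) (x y : nat -> 'I_m) : R :=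
  if pselect (exists k, x k != y k) is left xy then r ^+ ex_minn xy else 0.

Definition bilipschitz_equivalent (R : realType) (T U : Type)
    (dT : T -> T -> R) (dU : U -> U -> R) : Prop :=
  exists f : T -> U, bijective f /\
    exists C : R, 0 < C /\
      forall x y, C^-1 * dT x y <= dU (f x) (f y) <= C * dT x y.

(* Main.v *)
(* Call two cylinders of level k linked when they are at distance at most     *)
(* n^-k, and consider the components of this relation. Total disconnectedness *)
(* and the discreteness of G bound the diameter of a component by a multiple  *)
(* of n^-k, so that, without complete overlaps, components have boundedly     *)
(* many cylinders and finitely many shapes. The shapes are the vertices of    *)
(* the graph; a component of weight w (number of cylinders) splits into       *)
(* components of total weight m w, so the weights form the eigenvector.       *)
(*                                                                            *)
(* For the bilipschitz map, E is the boundary of the tree of components, and  *)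
(* two trees have bilipschitz boundaries when one is obtained from the other  *)
(* by regrouping boundedly many nodes at each level. A component of maximal   *)
(* weight reappears, as an exact copy, below every component (the star        *)
(* components are those below such a copy). The weights of star components    *)
(* have a gcd d, and, all occurring often, they can be packed exactly into    *)
(* bins: a star component of weight w behaves like w/d copies of the m-ary    *)
(* tree. Since s copies of the m-ary tree are equivalent to one copy, these   *)
(* may be stretched at will, and this slack allows the remaining components   *)
(* to be packed without any arithmetic condition.                             *)

Require Import Defs.
From HB Require Import structures.
From mathcomp Require Import all_boot all_order all_algebra.
From mathcomp Require Import all_classical all_reals all_analysis.
From mathcomp Require Import zify ring lra.

Set Implicit Arguments.
Unset Strict Implicit.
Unset Printing Implicit Defensive.

Import Order.TTheory GRing.Theory Num.Theory.
Import numFieldNormedType.Exports.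

Local Open Scope classical_set_scope.
Local Open Scope ring_scope.

(** * Packing weights into bins *)

Section Packing.
Local Open Scope nat_scope.

(** Rescaled by [n ^+ k], a cylinder of level [k] is a copy [h E + a] of [E] with [h] in the finite
    group and [a] in the lattice ([word_mapE]). A bounded region meets finitely many such copies,
    and a finite union of compact totally disconnected sets contains no long chain of very small
    steps ([totally_disconnected_thin], [thin_union]); hence a component of level [k] has diameter
    of order [n ^- k] ([component_diameter]). In this scale its cylinders differ from one another by
    finitely many pairs of a rotation and a shift ([component_shifts]), and without complete
    overlaps such a pair determines the word. This bounds the weights and gives the graph
    ([self_similar_dust_class]).

    For the second claim both spaces are coded by the paths of a tree, distances being comparable to
    powers of the ratio with the length of the common prefix as exponent ([component_coding],
    [symbolic_coding]). A bijection of paths that loses boundedly many levels of agreement is then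
    bilipschitz ([coded_bilipschitz]), and one arises whenever children can be grouped so as to
    match prescribed labels ([regrouping_equiv]). [tree_equiv] finds the groupings, with [J] levels
    taken in one step so that there are many children to choose from: [exact_packing] handles star
    components, where all weights are multiples of [d], and [slack_packing] the others, where
    stretchable units fill the gaps. *)

Lemma extract_weights (T : eqType) (wt : T -> nat) (L : seq nat) (xs : seq T) :
  (forall u, count_mem u L <= count_mem u (map wt xs)) ->
  exists zs ys, perm_eq xs (zs ++ ys) /\ map wt zs = L.
Proof.
elim: L xs => [|a L IH] xs hc; first by exists [::], xs.
have /mapP[x xxs ax] : a \in map wt xs.
  rewrite -has_pred1 has_count (leq_trans _ (hc a)) //= eqxx //.
have pxs := perm_to_rem xxs.
have hc' u : count_mem u L <= count_mem u (map wt (rem x xs)).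
  by move: (hc u); rewrite (permP (perm_map wt pxs)) /= -ax leq_add2l.
have [zs [ys [pzs zL]]] := IH _ hc'.
exists (x :: zs), ys; split; last by rewrite /= zL ax.
by rewrite (perm_trans pxs) //= perm_cons.
Qed.

Lemma greedy_prefix (T : Type) (wt : T -> nat) (M X : nat) (ys : seq T) :
  0 < M -> all (fun y => wt y <= M) ys -> X <= sumn (map wt ys) ->
  exists k, sumn (map wt (take k ys)) <= X < sumn (map wt (take k ys)) + M.
Proof.
move=> M0; elim: ys X => [|y ys IH] X /=; first by exists 0; lia.
case/andP=> yM aM XS; have [yX|yX] := leqP (wt y) X; last by exists 0 => /=; lia.
have [|k hk] := IH (X - wt y) aM; first lia.
by exists k.+1 => /=; lia.
Qed.

Lemma take_flatten_nseq (T : Type) (P : seq T) (t M : nat) : t <= M ->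
  take (t * size P) (flatten (nseq M P)) = flatten (nseq t P).
Proof.
move=> tM; rewrite -(subnKC tM) nseqD flatten_cat take_size_cat //.
by rewrite size_flatten /shape map_nseq sumn_nseq mulnC.
Qed.

Lemma sumn_flatten_nseq (P : seq nat) (t : nat) :
  sumn (flatten (nseq t P)) = t * sumn P.
Proof. by rewrite sumn_flatten map_nseq sumn_nseq mulnC. Qed.

Section ExactPacking.
Variables (T : eqType) (wt : T -> nat) (d M N : nat) (P Q : seq nat).
Let K := flatten (nseq M P) ++ flatten (nseq M Q).
Hypotheses (d0 : 0 < d) (M0 : 0 < M) (PQ : sumn P = sumn Q + d).
Hypotheses (dQ : d %| sumn Q) (NK : 2 * sumn K <= d * N).

(* Each bin is filled greedily up to an error below [M]; exchanging copies of *)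
(* [Q] for copies of [P] then corrects the error, which is a multiple of [d]. *)
Lemma exact_packing_reserved (s : nat) (ys zs : seq T) :
  map wt zs = flatten (nseq s.+1 K) ->
  all (fun x => (d %| wt x) && (wt x <= M)) (ys ++ zs) ->
  sumn (map wt (ys ++ zs)) = s.+1 * (d * N) ->
  exists gs : seq (seq T), [/\ size gs = s.+1, perm_eq (flatten gs) (ys ++ zs) &
    all (fun g => sumn (map wt g) == d * N) gs].
Proof.
elim: s ys zs => [|s IH] ys zs hzs hall hsum.
  exists [:: ys ++ zs]; split => //=; first by rewrite cats0.
  by rewrite hsum mul1n eqxx.
pose z1 := take (size K) zs; pose z' := drop (size K) zs.
have z1K : map wt z1 = K by rewrite map_take hzs /= take_size_cat.
have z'K : map wt z' = flatten (nseq s.+1 K) by rewrite map_drop hzs /= drop_size_cat.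
have ezs : zs = z1 ++ z' by rewrite cat_take_drop.
pose nP := size (flatten (nseq M P)).
pose zp := take nP z1; pose zq := drop nP z1.
have zpE : map wt zp = flatten (nseq M P) by rewrite map_take z1K take_size_cat.
have zqE : map wt zq = flatten (nseq M Q) by rewrite map_drop z1K drop_size_cat.
have ez1 : z1 = zp ++ zq by rewrite cat_take_drop.
clearbody zp zq z1 z'.
have sK : sumn K = M * (2 * sumn Q + d).
  rewrite sumn_cat !sumn_flatten_nseq PQ; lia.
have sys : sumn (map wt ys) + s.+2 * sumn K = s.+2 * (d * N).
  by rewrite -hsum map_cat sumn_cat hzs sumn_flatten_nseq.
have hys : all (fun x => (d %| wt x) && (wt x <= M)) ys.
  by move: hall; rewrite all_cat => /andP[].
have MQ : M * sumn Q <= d * N by move: NK; rewrite sK; nia.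
(* The target leaves room for [M] copies of [Q]; by [NK] the items not reserved weigh enough to
   reach it. *)
have [k /andP[k1 k2]] : exists k, sumn (map wt (take k ys)) <= d * N - M * sumn Q
    < sumn (map wt (take k ys)) + M.
  apply: greedy_prefix => //.
    by apply: sub_all hys => x /andP[].
  by move: sys NK; nia.
pose G0 := take k ys; pose gap := d * N - M * sumn Q - sumn (map wt G0).
have dgap : d %| gap.
  rewrite /gap; apply: dvdn_sub; first by apply: dvdn_sub; [exact: dvdn_mulr | exact: dvdn_mull].
  rewrite sumnE big_map big_seq; apply: dvdn_sum => x /mem_take xys.
  by have /andP[] := allP hys _ xys.
pose t := gap %/ d.
have tE : t * d = gap by exact: divnK dgap.
have tM : t <= M.
  by apply: leq_trans (leq_pmulr t d0) _; rewrite tE; move: k2; rewrite -/G0 /gap; lia.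
pose cp := t * size P; pose cq := (M - t) * size Q.
pose g := G0 ++ take cp zp ++ take cq zq.
have sg : sumn (map wt g) = d * N.
  rewrite !map_cat !sumn_cat [map wt (take cp zp)]map_take [map wt (take cq zq)]map_take zpE zqE !take_flatten_nseq ?leq_subr //.
  rewrite !sumn_flatten_nseq PQ.
  have -> : t * (sumn Q + d) = t * sumn Q + gap by rewrite mulnDr tE.
  have -> : (M - t) * sumn Q = M * sumn Q - t * sumn Q by rewrite mulnBl.
  have h1 : t * sumn Q <= M * sumn Q by rewrite leq_mul2r tM orbT.
  have h2 : gap + sumn (map wt G0) + M * sumn Q = d * N by rewrite /gap; move: k1; rewrite -/G0; lia.
  have aux a b c e f : b <= c -> f + a + c = e -> a + (b + f + (c - b)) = e by lia.
  exact: aux h1 h2.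
pose ys' := drop k ys ++ drop cp zp ++ drop cq zq.
have pall : perm_eq (ys ++ zs) (g ++ (ys' ++ z')).
  apply/permP => a; rewrite ezs ez1 -{1}(cat_take_drop k ys).
  rewrite -{1}(cat_take_drop cp zp) -{1}(cat_take_drop cq zq).
  by rewrite /g /ys' -/G0 !count_cat; lia.
have [||gs [sgs pgs ags]] := IH ys' z' z'K.
- by move: hall; rewrite (perm_all _ pall) all_cat => /andP[].
- by move: hsum; rewrite (perm_sumn (perm_map wt pall)) map_cat sumn_cat sg [s.+2 * _]mulSn => /addnI.
exists (g :: gs); split => /=; first by rewrite sgs.
- rewrite perm_sym (perm_trans pall) // perm_cat2l perm_sym //.
- by rewrite sg eqxx.
Qed.

(** Before any filling, one copy of [K] per bin is set aside; the abundance in [xs] of each weight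
    of [P] and [Q] makes this possible. *)
Lemma exact_packing (s : nat) (xs : seq T) :
  0 < s ->
  all (fun x => (d %| wt x) && (wt x <= M)) xs ->
  sumn (map wt xs) = s * (d * N) ->
  (forall u, u \in P ++ Q -> s * size K <= count_mem u (map wt xs)) ->
  exists gs : seq (seq T), [/\ size gs = s, perm_eq (flatten gs) xs &
    all (fun g => sumn (map wt g) == d * N) gs].
Proof.
case: s => // s _ hall hsum hcount.
have [u|zs [ys [pxs zsE]]] := @extract_weights T wt (flatten (nseq s.+1 K)) xs.
  have [uPQ|uPQ] := boolP (u \in P ++ Q).
    apply: leq_trans (count_size _ _) _; apply: leq_trans (hcount _ uPQ).
    by rewrite size_flatten /shape map_nseq sumn_nseq mulnC.
  apply: leq_trans (leq0n _); rewrite leqNgt -has_count has_pred1.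
  apply: contra uPQ => /flattenP[k /nseqP[-> _]].
  by rewrite mem_cat => /orP[] /flattenP[k' /nseqP[-> _]]; rewrite mem_cat => ->; rewrite ?orbT.
have pxs' : perm_eq xs (ys ++ zs) by rewrite (perm_trans pxs) // perm_catC.
have [||gs [sgs pgs ags]] := exact_packing_reserved zsE (ys := ys).
- by rewrite -(perm_all _ pxs').
- by rewrite -(perm_sumn (perm_map wt pxs')).
by exists gs; split => //; rewrite (perm_trans pgs) // perm_sym.
Qed.

End ExactPacking.

(** If no bin could take the next item, each would already hold at least [N - z x], more than the
    total allows. The strict bound keeps a free slot in every bin, to be filled by a unit. *)
Lemma greedy_packing (T : eqType) (z : T -> nat) (Z B N : nat) (zs : seq T) :
  0 < B -> 0 < N -> all (fun x => 0 < z x <= Z) zs ->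
  sumn (map z zs) + B * Z <= B * N ->
  exists gs : seq (seq T), [/\ size gs = B, perm_eq (flatten gs) zs &
    all (fun g => sumn (map z g) < N) gs].
Proof.
move=> B0 N0; elim: zs => [|x zs IH] /=.
  move=> _ _; exists (nseq B [::]); rewrite size_nseq; split => //.
  - by apply/permP => a; elim: (B).
  - by apply/allP => g /nseqP[->].
case/andP=> /andP[zx0 zxZ] hall hsum.
have [||gs [sgs pgs ags]] := IH; [by []|lia|].
have /hasP[g ggs gN] : has (fun g => sumn (map z g) + z x < N) gs.
  apply/negPn/negP; rewrite -all_predC => /allP hN.
  have : B * (N - z x) <= sumn (map z zs).
    rewrite -(perm_sumn (perm_map z pgs)) -sgs.
    elim: gs hN {sgs pgs ags} => // g gs IHg hN /=.
    rewrite map_cat sumn_cat mulSn leq_add //.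
      by have := hN g (mem_head _ _); rewrite /= -leqNgt; lia.
    by apply: IHg => g' g'gs; apply: hN; rewrite inE g'gs orbT.
  nia.
case/splitPr: ggs sgs pgs ags => g1 g2 sgs pgs ags.
exists (g1 ++ (x :: g) :: g2); split.
- by move: sgs; rewrite !size_cat.
- apply/permP => a; have /permP/(_ a) := pgs; rewrite !flatten_cat !count_cat /= ?count_cat /= ?count_cat; lia.
- move: ags; rewrite !all_cat /= => /and3P[-> _ ->]; rewrite andbT /=; lia.
Qed.

(** Every bin needs a unit, since only a unit can stretch to fill the slots left. The first bin
    takes as many as fit while one is kept for each later bin. *)
Lemma distribute_units (Ls : seq nat) (o : nat) :
  all (leq 1) Ls -> size Ls <= o <= sumn Ls ->
  exists cs, [/\ size cs = size Ls, sumn cs = o &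
    all2 (fun c L => 0 < c <= L) cs Ls].
Proof.
elim: Ls o => [|L Ls IH] o /=; first by move=> _ ho; exists [::]; split => //=; lia.
case/andP=> L0 hL ho.
have sL : size Ls <= sumn Ls by elim: Ls hL {IH ho} => //= a l IH /andP[a0 /IH]; lia.
have [|cs [scs socs]] := IH (o - minn L (o - size Ls)) hL; first lia.
move=> acs; exists (minn L (o - size Ls) :: cs); split => /=; lia.
Qed.

Definition forget (T S : Type) (x : T + S) : option T :=
  if x is inl t then Some t else None.

(* Units are flexible: the one marked [inr s] absorbs [s] slots, so the last  *)
(* unit of each bin takes up whatever the items of [zs] leave free.           *)
Lemma slack_packing (T : eqType) (z : T -> nat) (Z B N o : nat) (zs : seq T) :
  0 < B -> 0 < N -> all (fun x => 0 < z x <= Z) zs ->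
  sumn (map z zs) + B * Z <= B * N ->
  B <= o -> sumn (map z zs) + o <= B * N ->
  exists gs : seq (seq (T + nat)%type), [/\ size gs = B,
    perm_eq (map (@forget T nat) (flatten gs)) (map Some zs ++ nseq o None),
    all (fun g => sumn [seq (match x with inl t => z t | inr s => s end) | x <- g]
                  == N) gs &
    all (fun x => if x is inr s then 0 < s <= N else true) (flatten gs)].
Proof.
move=> B0 N0 hz hsum hBo hoN.
have [gs [sgs pgs ags]] := greedy_packing B0 N0 hz hsum.
pose Ls := [seq N - sumn (map z g) | g <- gs].
have sLs : sumn Ls + sumn (map z zs) = B * N.
  rewrite -(perm_sumn (perm_map z pgs)) -sgs /Ls.
  elim: gs ags {sgs pgs Ls} => //= g gs IH /andP[gN /IH]; rewrite map_cat sumn_cat mulSn; lia.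
have [||cs [scs so acs]] := @distribute_units Ls o.
- by apply/allP => L /mapP[g ggs ->]; have := allP ags _ ggs; lia.
- by rewrite size_map sgs; lia.
have {acs} : all2 (fun c g => 0 < c <= N - sumn (map z g)) cs gs.
  move: acs; rewrite /Ls; elim: cs (gs) {scs so} => [|c cs IHcs] [|g gs'] //=.
  by case/andP=> -> /IHcs.
rewrite size_map in scs.
rewrite -so -sgs => {sLs Ls so hoN hBo o hsum B0} acs.
pose fill c (g : seq T) : seq (T + nat) :=
  map inl g ++ nseq c.-1 (inr 1) ++ [:: inr (N - sumn (map z g) - c.-1)].
exists [seq fill p.1 p.2 | p <- zip cs gs]; split.
- by rewrite size_map size_zip scs minnn.
- apply/permP => a.
  have -> : count a (map Some zs ++ nseq (sumn cs) None) =
     count a (map Some (flatten gs) ++ nseq (sumn cs) None).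
    by rewrite !count_cat (permP (perm_map Some pgs)).
  elim: cs gs {sgs pgs} acs ags scs => [|c cs IH] [|g gs] //=.
  case/andP=> hc acs /andP[hg ags] [scs].
  have := IH gs acs ags scs.
  have eS : map (@forget T nat) (map inl g) = map Some g by rewrite -map_comp.
  rewrite !map_cat !count_cat eS !count_nseq !map_nseq /= !count_nseq => ->.
  by case: (a None) => /=; lia.
- elim: cs gs {sgs pgs} acs ags scs => [|c cs IH] [|g gs] //=.
  case/andP=> hc acs /andP[hg ags] [scs]; rewrite IH // andbT.
  rewrite !map_cat !sumn_cat -map_comp map_nseq sumn_nseq /=.
  rewrite (_ : map _ g = map z g) //; lia.
- elim: cs gs {sgs pgs} acs ags scs => [|c cs IH] [|g gs] //=.
  case/andP=> hc acs /andP[hg ags] [scs]; rewrite all_cat IH // andbT.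
  rewrite !all_cat /= andbT; apply/and3P; split; last by lia.
    by apply/allP => x /mapP[y _ ->].
  by apply/allP => x /nseqP[-> _]; lia.
Qed.

(* [d] is the least positive difference of two sums over [U]; it plays the    *)
(* role of the gcd of [U], with [P] and [Q] as Bezout coefficients.           *)
Lemma min_sum_difference (U : nat -> Prop) (u0 : nat) : U u0 -> 0 < u0 ->
  exists (d : nat) (P Q : seq nat), [/\ 0 < d, sumn P = sumn Q + d,
    (forall u, u \in P ++ Q -> U u) & (forall u, U u -> d %| u)].
Proof.
move=> Uu0 u00.
pose isdiff d := `[< 0 < d /\ exists P Q : seq nat, sumn P = sumn Q + d /\
    forall u, u \in P ++ Q -> U u >].
have ex : exists d, isdiff d.
  exists u0; apply/asboolP; split => //; exists [:: u0], [::]; split; first by rewrite /=; lia.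
  by move=> u; rewrite cats0 inE => /eqP->.
case: (ex_minnP ex) => d /asboolP[d0 [P [Q [PQ hPQ]]]] dmin.
exists d, P, Q; split => // u Uu.
rewrite /dvdn; case: posnP => // r0; exfalso.
have : isdiff (u %% d).
  apply/asboolP; split => //.
  (* Since [sumn P = sumn Q + d], adding [u %/ d] copies of [Q] to [u] and subtracting as many
     copies of [P] leaves the remainder, against the minimality of [d]. *)
  exists (u :: flatten (nseq (u %/ d) Q)), (flatten (nseq (u %/ d) P)); split.
    rewrite /= !sumn_flatten_nseq PQ {1}(divn_eq u d); lia.
  move=> v; rewrite mem_cat inE -orbA => /or3P[/eqP->//||] /flattenP[l /nseqP[-> _]] vl;
  by apply: hPQ; rewrite mem_cat vl ?orbT.
by move/dmin; rewrite leqNgt ltn_mod d0.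
Qed.

End Packing.

(** * Boundaries of trees *)

Section FlattenIndex.
Local Open Scope nat_scope.
Variables (T : Type) (x0 : T).
Implicit Type ss : seq (seq T).

Lemma nth_shape ss e : nth 0 (shape ss) e = size (nth [::] ss e).
Proof.
have [es|es] := ltnP e (size ss); first by rewrite (nth_map [::]).
by rewrite !nth_default // size_map.
Qed.

Lemma flatten_index_lt ss e r : r < size (nth [::] ss e) ->
  flatten_index (shape ss) e r < size (flatten ss).
Proof. by move=> rs; rewrite size_flatten flatten_indexP // nth_shape. Qed.

Lemma nth_flatten_index ss e r : r < size (nth [::] ss e) ->
  nth x0 (flatten ss) (flatten_index (shape ss) e r) = nth x0 (nth [::] ss e) r.
Proof.
by move=> rs; rewrite nth_flatten flatten_indexKl ?flatten_indexKr // nth_shape.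
Qed.

Lemma reshape_index_lt ss p : p < size (flatten ss) ->
  reshape_index (shape ss) p < size ss.
Proof. by rewrite size_flatten => /reshape_indexP; rewrite size_map. Qed.

Lemma reshape_offset_lt ss p : p < size (flatten ss) ->
  reshape_offset (shape ss) p < size (nth [::] ss (reshape_index (shape ss) p)).
Proof. by rewrite size_flatten => /reshape_offsetP; rewrite nth_shape. Qed.

End FlattenIndex.

(** A path records positions of children, and equal children may occur at several positions; a
    permutation has to become a bijection of positions. *)
Lemma perm_eq_index (T : eqType) (x0 : T) (s t : seq T) : perm_eq s t ->
  exists f g : nat -> nat,
    (forall p, (p < size s)%N ->
      [/\ (f p < size t)%N, nth x0 t (f p) = nth x0 s p & g (f p) = p]) /\
    (forall i, (i < size t)%N -> (g i < size s)%N /\ f (g i) = i).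
Proof.
move=> pst; have sst := perm_size pst.
have /(perm_iotaP x0)[Is pIs sE] := pst.
have szI : size Is = size t by rewrite (perm_size pIs) size_iota.
have uI : uniq Is by rewrite (perm_uniq pIs) iota_uniq.
exists (nth 0%N Is), (index^~ Is); split => [p ps|i it].
  rewrite sst -szI in ps; split.
  - by have := mem_nth 0%N ps; rewrite (perm_mem pIs) mem_iota.
  - by rewrite [in RHS]sE (nth_map 0%N).
  - by rewrite index_uniq.
have iI : i \in Is by rewrite (perm_mem pIs) mem_iota.
by rewrite sst -szI index_mem nth_index.
Qed.

Section Trees.
Local Open Scope nat_scope.

Section Paths.
Variables (V : Type) (x0 : V) (ch : V -> seq V).

Fixpoint node_at (v : V) (i : nat -> nat) (k : nat) : V :=
  if k is k'.+1 then nth x0 (ch (node_at v i k')) (i k') else v.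

Definition tree_path (v : V) (i : nat -> nat) : Prop :=
  forall k, i k < size (ch (node_at v i k)).

(* The first index selects a tree of [ts], the next ones a path in it. *)
Definition forest_path (ts : seq V) (i : nat -> nat) : Prop :=
  i 0 < size ts /\ tree_path (nth x0 ts (i 0)) (fun k => i k.+1).

End Paths.

Definition agree_below (k : nat) (p q : nat -> nat) : Prop :=
  forall j, j < k -> p j = q j.

(** Agreement of two paths is lost by at most [c] levels in either direction. For a metric that is a
    power of the ratio in the length of agreement, this is bilipschitz equivalence. *)
Definition path_equiv (P Q : (nat -> nat) -> Prop) : Prop :=
  exists (f h : (nat -> nat) -> nat -> nat) (c : nat),
    [/\ (forall p, P p -> Q (f p) /\ h (f p) = p),
        (forall q, Q q -> P (h q) /\ f (h q) = q),
        (forall p p' k, P p -> P p' -> agree_below (k + c) p p' ->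
           agree_below k (f p) (f p')) &
        (forall q q' k, Q q -> Q q' -> agree_below (k + c) q q' ->
           agree_below k (h q) (h q'))].

Lemma agree_below_le k k' p q : k <= k' -> agree_below k' p q -> agree_below k p q.
Proof. by move=> kk' h j jk; apply: h; apply: leq_trans kk'. Qed.

Lemma path_equiv_sym P Q : path_equiv P Q -> path_equiv Q P.
Proof. by case=> f [h [c [h1 h2 h3 h4]]]; exists h, f, c; split. Qed.

Lemma path_equiv_trans P Q O : path_equiv P Q -> path_equiv Q O -> path_equiv P O.
Proof.
case=> f [h [c [f1 h1 f2 h2]]] [f' [h' [c' [f1' h1' f2' h2']]]].
exists (f' \o f), (h \o h'), (c + c'); split => /=.
- by move=> p /f1[Qfp hfp]; have [Of' hf'] := f1' _ Qfp; rewrite hf'.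
- by move=> p /h1'[Qfp hfp]; have [Of' hf'] := h1 _ Qfp; rewrite hf'.
- move=> p p' k Pp Pp' pp'; have [Q1 _] := f1 _ Pp; have [Q2 _] := f1 _ Pp'.
  by apply: f2' => //; apply: f2 => //; rewrite -addnA [c' + c]addnC.
- move=> p p' k Pp Pp' pp'; have [Q1 _] := h1' _ Pp; have [Q2 _] := h1' _ Pp'.
  by apply: h2 => //; apply: h2' => //; rewrite -addnA.
Qed.

Section Regrouping.
Variables (U W : eqType) (u0 : U) (w0 : W) (chU : U -> seq U) (chW : W -> seq W).
Variables (lab : U -> seq W) (inv : U -> Prop).

(* The ends of the tree below [u] are to correspond to those of the forest    *)
(* [lab u]. The nodes in the label of a child of [u] must be children of a    *)
(* single node of [lab u]; this keeps labels local and the correspondence     *)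
(* bilipschitz.                                                               *)
Definition regroups (u : U) : Prop := exists gs : seq (seq U),
  [/\ size gs = size (lab u), perm_eq (flatten gs) (chU u) &
      forall j, j < size (lab u) ->
        perm_eq (flatten (map lab (nth [::] gs j))) (chW (nth w0 (lab u) j))].

Hypotheses (invU : forall u, inv u -> forall x, x \in chU u -> inv x).
Hypothesis (lab_regroups : forall u, inv u -> regroups u).

(* [F] sends child [c] of the [e]-th node of [lab u] to element [e'] of the   *)
(* label of child [i] of [u]; [loc] and [B] invert it, and [loc] depends on   *)
(* [i] alone.                                                                 *)
Lemma regrouping_index u : inv u ->
  exists (loc : nat -> nat) (F : nat -> nat -> nat * nat) (B : nat -> nat -> nat),
  (forall e c, e < size (lab u) -> c < size (chW (nth w0 (lab u) e)) ->
     [/\ (F e c).1 < size (chU u),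
         (F e c).2 < size (lab (nth u0 (chU u) (F e c).1)),
         nth w0 (lab (nth u0 (chU u) (F e c).1)) (F e c).2 =
           nth w0 (chW (nth w0 (lab u) e)) c,
         loc (F e c).1 = e & B (F e c).1 (F e c).2 = c]) /\
  (forall i, i < size (chU u) -> loc i < size (lab u) /\
     forall e', e' < size (lab (nth u0 (chU u) i)) ->
       B i e' < size (chW (nth w0 (lab u) (loc i))) /\
       F (loc i) (B i e') = (i, e')).
Proof.
move=> /lab_regroups[gs [sgs /(perm_eq_index u0)[f [g [fP gP]]] hgs]].
have /choice[fg fgP] : forall e, exists fg : (nat -> nat) * (nat -> nat),
  e < size (lab u) ->
  (forall p, p < size (flatten (map lab (nth [::] gs e))) ->
      [/\ fg.1 p < size (chW (nth w0 (lab u) e)),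
          nth w0 (chW (nth w0 (lab u) e)) (fg.1 p) =
          nth w0 (flatten (map lab (nth [::] gs e))) p & fg.2 (fg.1 p) = p]) /\
    (forall i, i < size (chW (nth w0 (lab u) e)) ->
       fg.2 i < size (flatten (map lab (nth [::] gs e))) /\ fg.1 (fg.2 i) = i).
  move=> e; have [es|es] := ltnP e (size (lab u)); last by exists (id, id).
  by have /(perm_eq_index w0)[f' [g' h]] := hgs _ es; exists (f', g').
pose G e := nth [::] gs e.
pose loc i := reshape_index (shape gs) (g i).
pose F e c := let q := (fg e).2 c in
  (f (flatten_index (shape gs) e (reshape_index (shape (map lab (G e))) q)),
   reshape_offset (shape (map lab (G e))) q).
pose B i e' := (fg (loc i)).1 (flatten_index (shape (map lab (G (loc i))))
                 (reshape_offset (shape gs) (g i)) e').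
have nlab e r : r < size (G e) ->
    nth [::] (map lab (G e)) r = lab (nth u0 (G e) r).
  by move=> rs; rewrite (nth_map u0).
exists loc, F, B; split => [e c es cs|i ich].
- have [fgP1 /(_ _ cs)[qs qK]] := fgP _ es.
  rewrite /F /=; set q := (fg e).2 c; set sh := shape (map lab (G e)).
  have rs : reshape_index sh q < size (G e).
    by have := reshape_index_lt qs; rewrite size_map.
  have es' : reshape_offset sh q < size (lab (nth u0 (G e) (reshape_index sh q))).
    by have := reshape_offset_lt qs; rewrite nlab.
  have [fps fpE gfp] := fP _ (flatten_index_lt rs).
  have locE : loc (f (flatten_index (shape gs) e (reshape_index sh q))) = e.
    by rewrite /loc gfp flatten_indexKl // nth_shape.
  have nE : nth u0 (chU u) (f (flatten_index (shape gs) e (reshape_index sh q))) =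
      nth u0 (G e) (reshape_index sh q).
    by rewrite fpE nth_flatten_index.
  have [_ cE _] := fgP1 _ qs.
  split => //; rewrite ?nE //.
  + by rewrite -{1}qK cE nth_flatten nlab.
  + rewrite /B locE gfp flatten_indexKr ?nth_shape // -/sh reshape_indexK.
    exact: qK.
- have [gs_i fgi] := gP _ ich.
  have ls := reshape_index_lt gs_i; rewrite sgs in ls.
  have os := reshape_offset_lt gs_i.
  split => // e' e'l.
  have [fgP1 fgP2] := fgP _ ls.
  have nE : nth u0 (chU u) i = nth u0 (G (loc i)) (reshape_offset (shape gs) (g i)).
    have [_ + _] := fP _ gs_i; rewrite fgi => ->.
    by rewrite nth_flatten.
  have e's : e' < size (nth [::] (map lab (G (loc i))) (reshape_offset (shape gs) (g i))).
    by rewrite nlab // -nE.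
  have [bs _ bK] := fgP1 _ (flatten_index_lt e's).
  split; first exact: bs.
  rewrite /F /= /B bK.
  by rewrite flatten_indexKl ?nth_shape // flatten_indexKr ?nth_shape // reshape_indexK fgi.
Qed.

(** Both maps follow one state: a node of the tree of [u] and a position in its label, standing for
    the node that the forest path has reached. A forest path has one index more, the choice of a
    tree, so recovering index [k] takes its first [k.+2] indices: hence [c = 1]. *)
Lemma regrouping_equiv u : inv u ->
  path_equiv (tree_path u0 chU u) (forest_path w0 chW (lab u)).
Proof.
move=> invu.
have /choice[D DP] : forall v, exists D : (nat -> nat) * (nat -> nat -> nat * nat) *
    (nat -> nat -> nat), inv v ->
  (forall e c, e < size (lab v) -> c < size (chW (nth w0 (lab v) e)) ->
     [/\ (D.1.2 e c).1 < size (chU v),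
         (D.1.2 e c).2 < size (lab (nth u0 (chU v) (D.1.2 e c).1)),
         nth w0 (lab (nth u0 (chU v) (D.1.2 e c).1)) (D.1.2 e c).2 =
           nth w0 (chW (nth w0 (lab v) e)) c,
         D.1.1 (D.1.2 e c).1 = e & D.2 (D.1.2 e c).1 (D.1.2 e c).2 = c]) /\
  (forall i, i < size (chU v) -> D.1.1 i < size (lab v) /\
     forall e', e' < size (lab (nth u0 (chU v) i)) ->
       D.2 i e' < size (chW (nth w0 (lab v) (D.1.1 i))) /\
       D.1.2 (D.1.1 i) (D.2 i e') = (i, e')).
  move=> v; have [iv|niv] := pselect (inv v); last first.
    by exists (id, (fun _ _ => (0, 0)), (fun _ _ => 0)).
  by have [loc [F [B h]]] := regrouping_index iv; exists (loc, F, B).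
pose loc v := (D v).1.1; pose F v := (D v).1.2; pose B v := (D v).2.
pose st (q : nat -> nat) := fix st k : U * nat :=
  if k is k'.+1 then
    (nth u0 (chU (st k').1) (F (st k').1 (st k').2 (q k)).1,
     (F (st k').1 (st k').2 (q k)).2)
  else (u, q 0).
pose h (q : nat -> nat) k := (F (st q k).1 (st q k).2 (q k.+1)).1.
pose nd i k := node_at u0 chU u i k.
(* The element of the next label to which the path descends is the one whose group contains the next
   index, hence [loc] at the following node. *)
pose f (i : nat -> nat) k :=
  if k is k'.+1 then B (nd i k') (i k') (loc (nd i k) (i k)) else loc u (i 0).
have fwd q : forest_path w0 chW (lab u) q -> forall k,
  [/\ inv (st q k).1, (st q k).2 < size (lab (st q k).1),
      nth w0 (lab (st q k).1) (st q k).2 =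
        node_at w0 chW (nth w0 (lab u) (q 0)) (fun k => q k.+1) k &
      nd (h q) k = (st q k).1].
  case=> q0 qP; elim=> [|k [ik sk nk dk]]; first by split.
  have qk := qP k; rewrite -nk in qk.
  have [a1 a2 a3 a4 a5] := (DP _ ik).1 _ _ sk qk.
  split => //=.
  - by apply: invU ik _ _; rewrite mem_nth.
  - by rewrite -nk.
  - have {}dk : node_at u0 chU u (h q) k = (st q k).1 := dk.
    by rewrite /nd /= dk.
have bwd i : tree_path u0 chU u i -> forall k,
  [/\ inv (nd i k), loc (nd i k) (i k) < size (lab (nd i k)),
      f i k.+1 < size (chW (nth w0 (lab (nd i k)) (loc (nd i k) (i k)))) &
      F (nd i k) (loc (nd i k) (i k)) (f i k.+1) = (i k, loc (nd i k.+1) (i k.+1))].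
  move=> iP.
  have base k : inv (nd i k).
    by elim: k => // k IH; apply: invU IH _ _; rewrite mem_nth //; exact: iP.
  have hloc k : loc (nd i k) (i k) < size (lab (nd i k)).
    by have [] := (DP _ (base k)).2 _ (iP k).
  by move=> k; have [_ /(_ _ (hloc k.+1))[]] := (DP _ (base k)).2 _ (iP k); split.
have bst i : tree_path u0 chU u i -> forall k,
    st (f i) k = (nd i k, loc (nd i k) (i k)).
  move=> iP; elim=> [|k IH] //=; rewrite IH /=.
  by have [_ _ _ ->] := bwd i iP k.
have bnode i : tree_path u0 chU u i -> forall k,
    nth w0 (lab (nd i k)) (loc (nd i k) (i k)) =
    node_at w0 chW (nth w0 (lab u) (f i 0)) (fun k => f i k.+1) k.
  move=> iP; elim=> [|k IH] //; rewrite [RHS]/= -IH.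
  have [ik lk bk Fk] := bwd i iP k.
  by have [_ _ + _ _] := (DP _ ik).1 _ _ lk bk; rewrite [(D _).1.2 _ _]Fk.
exists f, h, 1; split.
- move=> i iP; split; first split => [|k].
  + by have [] := bwd i iP 0.
  + by rewrite -bnode //; have [] := bwd i iP k.
  + by apply/funext => k; rewrite /h bst //=; have [_ _ _ ->] := bwd i iP k.
- move=> q qP; have hnd k : nd (h q) k = (st q k).1 by have [] := fwd q qP k.
  have hh k := fwd q qP k.
  have hF k : [/\ h q k < size (chU (st q k).1), loc (st q k).1 (h q k) = (st q k).2 &
     B (st q k).1 (h q k) (st q k.+1).2 = q k.+1].
    have [ik sk nk _] := hh k.
    have qk : q k.+1 < size (chW (nth w0 (lab (st q k).1) (st q k).2)).
      by rewrite nk; case: qP.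
    by have [? _ _ ? ?] := (DP _ ik).1 _ _ sk qk; split.
  split => [k|].
    by rewrite -/(nd _ k) hnd; have [] := hF k.
  apply/funext => -[|k] /=.
    by have [_ + _] := hF 0.
  rewrite -/(nd _ k.+1) !hnd; have [_ -> _] := hF k.+1.
  by have [_ _] := hF k.
- move=> i i' k _ _ ii'.
  have nE j : j <= k -> nd i j = nd i' j.
    rewrite /nd; elim: j => // j IH jk /=.
    by rewrite (IH (ltnW jk)) ii' // addn1 ltnS ltnW.
  move=> [|j] jk; rewrite /f; first by rewrite ii' // addn1.
  have j1k := ltnW jk; have jk' := ltnW j1k.
  by rewrite (nE _ j1k) (nE _ jk') !ii' // addn1 ltnS.
- move=> q q' k _ _ qq'.
  have sE j : j <= k -> st q j = st q' j.
    elim: j => [|j IH] jk /=; first by rewrite qq' // addn1.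
    by rewrite (IH (ltnW jk)) qq' // addn1 ltnS.
  by move=> j jk; rewrite /h (sE j (ltnW jk)) qq' // addn1 ltnS.
Qed.

End Regrouping.
End Trees.

(** * Metric spaces coded by paths *)

Section Coding.
Variable R : realType.

Lemma forest_path1 (V : Type) (x0 : V) (ch : V -> seq V) (v : V) :
  path_equiv (forest_path x0 ch [:: v]) (tree_path x0 ch v).
Proof.
exists (fun q k => q k.+1), (fun p k => if k is k'.+1 then p k' else 0%N), 1%N; split.
- move=> q []; rewrite ltnS leqn0 => /eqP q0; rewrite q0 => qP; split => //.
  by apply/funext => -[].
- by move=> p pP; split.
- by move=> q q' k _ _ qq' j jk; apply: qq'; rewrite addn1 ltnS.
- by move=> p p' k _ _ pp' [|j] // jk; apply: pp'; rewrite addn1 ltnS ltnW // ltnW.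
Qed.

(** The code is a bijection onto the paths under which [d] is comparable to [r ^+ k], with [k] the
    first index where two codes differ. *)
Definition coded_by (X : Type) (d : X -> X -> R) (r : R)
    (P : (nat -> nat) -> Prop) : Prop :=
  exists (a : X -> nat -> nat) (c : R), [/\ 0 < c,
    injective a /\ (forall x, d x x = 0),
    (forall x, P (a x)) /\ (forall p, P p -> exists x, a x = p),
    (forall x y k, agree_below k (a x) (a y) -> d x y <= c * r ^+ k) &
    (forall x y k, a x k <> a y k -> c^-1 * r ^+ k <= d x y)].

Lemma first_difference (p q : nat -> nat) : p <> q ->
  exists k, agree_below k p q /\ p k <> q k.
Proof.
move=> pq; have ex : exists k, p k != q k.
  apply: contrapT => /forallNP h; apply: pq; apply/funext => k.
  by apply/eqP/negPn/negP => /h.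
case: (ex_minnP ex) => k /eqP pqk kmin; exists k; split => // j jk.
by apply/eqP/negPn/negP => /kmin; rewrite leqNgt jk.
Qed.

(** The first differences of the two codes of a pair of points are at most [s] levels apart, which
    costs a factor [r ^- s] besides the two coding constants. *)
Lemma coded_bilipschitz (X Y : Type) (dX : X -> X -> R) (dY : Y -> Y -> R) (r : R)
    (P Q : (nat -> nat) -> Prop) : 0 < r < 1 ->
  coded_by dX r P -> coded_by dY r Q -> path_equiv P Q ->
  bilipschitz_equivalent dX dY.
Proof.
move=> /andP[r0 r1] [a [c [c0 [ainj dXx] [aP asurj] aup alow]]]
  [b [c' [c'0 [binj dYy] [bP bsurj] bup blow]]] [f [h [s [fP hP fs hs]]]].
have /choice[F FP] : forall x, exists y, b y = f (a x).
  by move=> x; apply: bsurj; have [] := fP _ (aP x).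
have /choice[G GP] : forall y, exists x, a x = h (b y).
  by move=> y; apply: asurj; have [] := hP _ (bP y).
exists F; split.
  exists G => [x|y].
    by apply: ainj; rewrite GP FP; have [] := fP _ (aP x).
  by apply: binj; rewrite FP GP; have [] := hP _ (bP y).
have rk k : 0 < r ^+ k by rewrite exprn_gt0.
exists (c * c' * (r ^+ s)^-1); split.
  by rewrite !mulr_gt0 ?invr_gt0.
move=> x y; have [->|xy] := pselect (x = y); first by rewrite dXx dYy !mulr0 lexx.
have [k [kag kdiff]] : exists k, agree_below k (a x) (a y) /\ a x k <> a y k.
  by apply: first_difference => /ainj.
have [k' [k'ag k'diff]] :
    exists k, agree_below k (b (F x)) (b (F y)) /\ b (F x) k <> b (F y) k.
  apply: first_difference => /binj e.
  have {}e : f (a x) = f (a y) by rewrite -!FP e.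
  by apply/xy/ainj; have [_ <-] := fP _ (aP x); have [_ <-] := fP _ (aP y); rewrite e.
have k'k : (k' <= k + s)%N.
  rewrite leqNgt; apply/negP => kk'; apply: kdiff.
  have [Qx hx] := fP _ (aP x); have [Qy hy] := fP _ (aP y).
  rewrite -hx -hy; apply: (hs _ _ k.+1) => //.
  by rewrite -!FP; apply: agree_below_le k'ag; rewrite addSn.
have kk' : (k <= k' + s)%N.
  rewrite leqNgt; apply/negP => kk'; apply: k'diff.
  rewrite !FP; apply: (fs _ _ k'.+1) => //.
  by apply: agree_below_le kag; rewrite addSn.
have d1 := aup _ _ _ kag; have d2 := alow _ _ _ kdiff.
have d3 := bup _ _ _ k'ag; have d4 := blow _ _ _ k'diff.
have e1 : r ^+ s * r ^+ k <= r ^+ k'.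
  by rewrite -exprD ler_wiXn2l ?ltW // addnC.
have e2 : r ^+ s * r ^+ k' <= r ^+ k.
  by rewrite -exprD ler_wiXn2l ?ltW // addnC.
have [nc nc' nr] : [/\ c != 0, c' != 0 & r ^+ s != 0] by split; apply: lt0r_neq0.
apply/andP; split.
  apply: le_trans d4.
  apply: (@le_trans _ _ ((c * c' / r ^+ s)^-1 * (c * r ^+ k))).
    by rewrite ler_wpM2l // invr_ge0 ltW // !mulr_gt0 ?invr_gt0.
  have -> : (c * c' / r ^+ s)^-1 * (c * r ^+ k) = c'^-1 * (r ^+ s * r ^+ k).
    by field; rewrite nc nc' nr.
  by rewrite ler_pM2l ?invr_gt0.
apply: le_trans d3 _.
have -> : c * c' / r ^+ s * dX x y = c' * (c * dX x y / r ^+ s) by ring.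
rewrite ler_pM2l // ler_pdivlMr // mulrC; apply: le_trans e2 _.
by move: d2; rewrite mulrC ler_pdivrMr // mulrC.
Qed.

End Coding.

(** * Euclidean distance, chains and thin sets *)

Section Euclidean.
Variables (R : realType) (l : nat).
Implicit Types (x y z : 'rV[R]_l) (A B : set 'rV[R]_l).

Lemma eucl_norm_ge0 x : 0 <= eucl_norm x.
Proof. exact: sqrtr_ge0. Qed.

Lemma sumsq_ge0 x : 0 <= \sum_(i < l) x ord0 i ^+ 2.
Proof. by apply: sumr_ge0 => i _; exact: sqr_ge0. Qed.

Lemma sqr_eucl_norm x : eucl_norm x ^+ 2 = \sum_(i < l) x ord0 i ^+ 2.
Proof. by rewrite sqr_sqrtr ?sumsq_ge0. Qed.

Lemma normr_le_eucl_norm x : `|x| <= eucl_norm x.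
Proof.
rewrite /Num.Def.normr /= mx_normrE; apply: bigmax_le => [|[i j] _].
  exact: eucl_norm_ge0.
rewrite /= ord1 -sqrtr_sqr ler_wsqrtr // (bigD1 j) //= lerDl.
by apply: sumr_ge0 => k _; exact: sqr_ge0.
Qed.

Lemma eucl_norm_le_normr x : eucl_norm x <= l%:R * `|x|.
Proof.
rewrite -[leRHS]ger0_norm ?mulr_ge0 // -sqrtr_sqr ler_wsqrtr //.
apply: (@le_trans _ _ (\sum_(i < l) `|x| ^+ 2)).
  apply: ler_sum => i _; rewrite -real_normK ?num_real // lerXn2r ?nnegrE //.
  rewrite [leRHS]/Num.Def.normr /= mx_normrE.
  by apply/bigmax_geP; right; exists (ord0, i).
rewrite sumr_const card_ord exprMn -[leLHS]mulr_natl ler_wpM2r ?sqr_ge0 //.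
by rewrite -natrX ler_nat; case: (l) => // k; rewrite leq_pmulr.
Qed.

Lemma eucl_norm0_eq0 x : eucl_norm x = 0 -> x = 0.
Proof.
move=> x0; apply/eqP; rewrite -normr_eq0 eq_le normr_ge0 andbT -x0.
exact: normr_le_eucl_norm.
Qed.

Lemma eucl_norm0 : eucl_norm (0 : 'rV[R]_l) = 0.
Proof. by rewrite /eucl_norm big1 ?sqrtr0 // => i _; rewrite mxE expr0n. Qed.

Lemma eucl_normZ (a : R) x : eucl_norm (a *: x) = `|a| * eucl_norm x.
Proof.
rewrite /eucl_norm -sqrtr_sqr -sqrtrM ?sqr_ge0 // mulr_sumr.
by congr (Num.sqrt _); apply: eq_bigr => i _; rewrite mxE exprMn.
Qed.

Lemma eucl_normN x : eucl_norm (- x) = eucl_norm x.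
Proof. by rewrite -scaleN1r eucl_normZ normrN1 mul1r. Qed.

Lemma eucl_dot_le x y :
  \sum_(i < l) x ord0 i * y ord0 i <= eucl_norm x * eucl_norm y.
Proof.
have [/eqP/eucl_norm0_eq0->|nx] := boolP (eucl_norm x == 0).
  by rewrite big1 ?eucl_norm0 ?mul0r // => i _; rewrite mxE mul0r.
have [/eqP/eucl_norm0_eq0->|ny] := boolP (eucl_norm y == 0).
  by rewrite big1 ?eucl_norm0 ?mulr0 // => i _; rewrite mxE mulr0.
set a := eucl_norm x in nx *; set b := eucl_norm y in ny *.
have a0 : 0 < a by rewrite lt_neqAle eq_sym nx eucl_norm_ge0.
have b0 : 0 < b by rewrite lt_neqAle eq_sym ny eucl_norm_ge0.
(* AM-GM for [x i * sqrt (b / a)] and [y i * sqrt (a / b)] *)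
have -> : a * b = \sum_(i < l) (x ord0 i ^+ 2 * (b / a / 2) + y ord0 i ^+ 2 * (a / b / 2)).
  rewrite big_split /= -!mulr_suml -!sqr_eucl_norm -/a -/b.
  by field; rewrite nx ny.
apply: ler_sum => i _; set u := x ord0 i; set v := y ord0 i.
rewrite -subr_ge0.
have -> : u ^+ 2 * (b / a / 2) + v ^+ 2 * (a / b / 2) - u * v =
    (u * b - v * a) ^+ 2 / (2 * a * b) by field; rewrite nx ny.
by rewrite divr_ge0 ?sqr_ge0 // ltW // !mulr_gt0.
Qed.

Lemma ler_eucl_normD x y : eucl_norm (x + y) <= eucl_norm x + eucl_norm y.
Proof.
rewrite -(@ler_pXn2r _ 2) ?nnegrE ?addr_ge0 ?eucl_norm_ge0 //.
rewrite sqr_eucl_norm sqrrD !sqr_eucl_norm.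
under eq_bigr do rewrite mxE sqrrD.
rewrite !big_split /= -addrA -[leRHS]addrA lerD2l lerD2r.
by rewrite -mulr2n lerMn2r /= eucl_dot_le.
Qed.

Lemma eucl_distxx x : eucl_dist x x = 0.
Proof. by rewrite /eucl_dist subrr eucl_norm0. Qed.

Lemma eucl_dist_ge0 x y : 0 <= eucl_dist x y.
Proof. exact: eucl_norm_ge0. Qed.

Lemma eucl_dist0_eq x y : eucl_dist x y = 0 -> x = y.
Proof. by move/eucl_norm0_eq0/eqP; rewrite subr_eq0 => /eqP. Qed.

Lemma eucl_distC x y : eucl_dist x y = eucl_dist y x.
Proof. by rewrite /eucl_dist -opprB eucl_normN. Qed.

Lemma eucl_dist_triangle y x z : eucl_dist x z <= eucl_dist x y + eucl_dist y z.
Proof. by rewrite /eucl_dist -(subrKA y x (- z)) ler_eucl_normD. Qed.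

Lemma eucl_distDr a x y : eucl_dist (x + a) (y + a) = eucl_dist x y.
Proof. by rewrite /eucl_dist opprD addrACA subrr addr0. Qed.

Lemma eucl_distZ (a : R) x y : eucl_dist (a *: x) (a *: y) = `|a| * eucl_dist x y.
Proof. by rewrite /eucl_dist -scalerBr eucl_normZ. Qed.

Lemma eucl_norm_dist0 x : eucl_norm x = eucl_dist x 0.
Proof. by rewrite /eucl_dist subr0. Qed.

Lemma nbhs_eucl x (P : set 'rV[R]_l) :
  nbhs x P <-> exists e, 0 < e /\ forall y, eucl_dist x y < e -> P y.
Proof.
split=> [/nbhs_ballP[e /= e0 eP]|[e [e0 eP]]].
  exists e; split => // y xy; apply: eP; rewrite -ball_normE /ball_ /=.
  exact: le_lt_trans (normr_le_eucl_norm _) xy.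
apply/nbhs_ballP; exists (e / l.+1%:R) => /=; first by rewrite divr_gt0.
move=> y; rewrite -ball_normE /ball_ /= => xy; apply: eP.
apply: le_lt_trans (eucl_norm_le_normr _) _.
apply: (@le_lt_trans _ _ (l.+1%:R * `|x - y|)).
  by rewrite ler_wpM2r // ler_nat.
by rewrite mulrC -ltr_pdivlMr.
Qed.

Lemma cluster_sequence A (u : nat -> 'rV[R]_l) : compact A -> (forall k, A (u k)) ->
  exists p, A p /\ forall e N, 0 < e -> exists k, (N <= k)%N /\ eucl_dist p (u k) < e.
Proof.
move=> cA uA.
have uAF : (u @ \oo) A by exists 0%N => // k _; exact: uA.
have [p [Ap clp]] := cA (u @ \oo) _ uAF.
exists p; split => // e N e0.
have [||_ [[k Nk <-] pk]] := clp [set u k | k in [set k | (N <= k)%N]]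
    [set y | eucl_dist p y < e].
- by exists N => // k /= Nk; exists k.
- by apply/nbhs_eucl; exists e.
by exists k.
Qed.

Lemma compact_eucl_bounded A : compact A ->
  exists D, 0 < D /\ forall x, A x -> eucl_norm x <= D.
Proof.
move=> cA; apply: contrapT => /forallNP h.
have /choice[u uP] : forall k : nat, exists x, A x /\ k%:R < eucl_norm x.
  move=> k; have := h k.+1%:R => /not_andP[|/existsNP[x /not_implyP[Ax xk]]].
    by rewrite ltr0n.
  exists x; split => //; apply: lt_trans (_ : _ < k.+1%:R) _; first by rewrite ltr_nat.
  by rewrite ltNge; apply/negP.
have [p [Ap hp]] := cluster_sequence cA (fun k => (uP k).1).
have [N hN] : exists N : nat, eucl_norm p + 1 <= N%:R.
  exists (Num.trunc (eucl_norm p + 1)).+1; apply/ltW/truncnS_gt.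
have [k [Nk pk]] := hp 1 N ltr01.
have := (uP k).2; rewrite ltNge => /negP; apply.
apply: (@le_trans _ _ (eucl_norm p + 1)); last first.
  by apply: le_trans hN _; rewrite ler_nat.
rewrite !eucl_norm_dist0; apply: le_trans (eucl_dist_triangle p _ _) _.
by rewrite addrC lerD2l ltW // eucl_distC.
Qed.

End Euclidean.

(** * Chains of small steps and total disconnectedness *)

Section Chains.
Variables (R : realType) (l : nat).
Implicit Types (x y z : 'rV[R]_l) (F A B : set 'rV[R]_l) (d e : R).

Inductive chain F d x : 'rV[R]_l -> Prop :=
| chain_refl : F x -> chain F d x x
| chain_step y z : chain F d x y -> F z -> eucl_dist y z <= d -> chain F d x z.

Lemma chain_start F d x y : chain F d x y -> F x.
Proof. by elim. Qed.

Lemma chain_end F d x y : chain F d x y -> F y.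
Proof. by elim. Qed.

Lemma chain_trans F d x y z : chain F d x y -> chain F d y z -> chain F d x z.
Proof.
by move=> xy; elim=> // u v _ xu Fv uv; apply: chain_step xu Fv uv.
Qed.

Lemma chain_map (h : 'rV[R]_l -> 'rV[R]_l) F F' d d' x y :
  (forall u, F u -> F' (h u)) ->
  (forall u v, eucl_dist u v <= d -> eucl_dist (h u) (h v) <= d') ->
  chain F d x y -> chain F' d' (h x) (h y).
Proof.
move=> FF' dd'; elim=> [Fx|u v _ xu Fv uv]; first exact/chain_refl/FF'.
by apply: chain_step xu (FF' _ Fv) (dd' _ _ uv).
Qed.

Lemma chain_le F d d' x y : d <= d' -> chain F d x y -> chain F d' x y.
Proof.
by move=> dd'; apply: (@chain_map id) => // u v /le_trans; apply.
Qed.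

Lemma chain_image (h : 'rV[R]_l -> 'rV[R]_l) F d x y :
  (forall u v, eucl_dist (h u) (h v) = eucl_dist u v) ->
  chain (h @` F) d x y ->
  exists x0 y0, [/\ x = h x0, y = h y0 & chain F d x0 y0].
Proof.
move=> hiso; elim=> [[x0 Fx0 <-]|u v _ [x0 [u0 [-> -> x0u0]]] [v0 Fv0 <-] uv].
  by exists x0, x0; split => //; apply: chain_refl.
exists x0, v0; split => //; apply: chain_step x0u0 Fv0 _.
by rewrite -hiso.
Qed.

(** A quantitative form of total disconnectedness, which holds for compact totally disconnected sets
    and passes to finite unions by handling chains alone. *)
Definition thin F : Prop := forall e, 0 < e -> exists d, 0 < d /\
  forall x y, chain F d x y -> eucl_dist x y <= e.

Lemma thin_subset F F' : F `<=` F' -> thin F' -> thin F.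
Proof.
move=> FF' tF' e /tF'[d [d0 h]]; exists d; split => // x y xy; apply: h.
exact: (@chain_map id) xy.
Qed.

Lemma thin0 : thin set0.
Proof. by move=> e e0; exists 1; split => // x y /chain_start. Qed.

Lemma thin_isometry (h : 'rV[R]_l -> 'rV[R]_l) F :
  (forall u v, eucl_dist (h u) (h v) = eucl_dist u v) -> thin F -> thin (h @` F).
Proof.
move=> hiso tF e /tF[d [d0 hd]]; exists d; split => // x y.
by move=> /(chain_image hiso)[x0 [y0 [-> -> /hd]]]; rewrite hiso.
Qed.

Lemma thin_small F e : thin F -> 0 < e -> exists d, [/\ 0 < d, d <= e &
  forall x y, chain F d x y -> eucl_dist x y <= e].
Proof.
move=> tF e0; have [d [d0 h]] := tF _ e0; exists (Num.min d e); split.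
- by rewrite lt_min d0.
- by rewrite ge_min lexx orbT.
by move=> x y xy; apply: h; apply: chain_le xy; rewrite ge_min lexx.
Qed.

(* With [db] small enough that [db]-chains in [B] are short compared with     *)
(* [da], the points of [A] on a [db]-chain in [A `|` B] form a [da]-chain.    *)
Lemma thin_union A B : thin A -> thin B -> thin (A `|` B).
Proof.
move=> tA tB e e0.
have e8 : 0 < e / 8 by rewrite divr_gt0.
have [da [da0 dae hA]] := thin_small tA e8.
have [|db [db0 dba hB]] := @thin_small B (da / 3) tB; first by rewrite divr_gt0.
exists db; split => // x y.
(* A chain that starts in [A]: the points met in [A], then possibly an excursion into [B] that is
   still going on. Entry, excursion and exit together cost at most three times [da / 3], a legal
   step in [A]. *)
pose Q x y := chain A da x y \/ exists a b,
  [/\ chain A da x a, eucl_dist a b <= db & chain B db b y].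
have Qstep u v w : Q u v -> (A `|` B) w -> eucl_dist v w <= db -> Q u w.
  move=> Quv ABw vw; case: ABw => [Aw|Bw].
    left; case: Quv => [uv|[a [b [ua ab bv]]]].
      by apply: chain_step uv Aw _; apply: le_trans vw _; lra.
    apply: chain_step ua Aw _; have := hB _ _ bv.
    have := eucl_dist_triangle b a w; have := eucl_dist_triangle v b w.
    by move: dba ab vw; lra.
  right; case: Quv => [uv|[a [b [ua ab bv]]]].
    by exists v, w; split => //; apply: chain_refl.
  by exists a, b; split => //; apply: chain_step bv Bw vw.
have Qdist u v : Q u v -> eucl_dist u v <= e / 2.
  case=> [/hA|[a [b [/hA ua ab /hB bv]]]]; first by move: e0; lra.
  have := eucl_dist_triangle a u v; have := eucl_dist_triangle b a v.
  by move: dae dba; lra.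
(* A general chain may begin with a stretch in [B]. *)
pose Q' x y := Q x y \/ chain B db x y \/ exists b a,
  [/\ chain B db x b, eucl_dist b a <= db & Q a y].
suff Q'P : chain (A `|` B) db x y -> Q' x y.
  move=> /Q'P[/Qdist|[/hB|[b [a [/hB xb ba /Qdist ay]]]]].
  - by move: e0; lra.
  - by move: dae e0; lra.
  have := eucl_dist_triangle b x y; have := eucl_dist_triangle a b y.
  by move: dae dba; lra.
elim=> [[Ax|Bx]|u v _ [Qxu|[xu|[b [a [xb ba au]]]]] ABv uv].
- by left; left; apply: chain_refl.
- by right; left; apply: chain_refl.
- by left; apply: Qstep Qxu ABv uv.
- case: ABv => [Av|Bv].
    by right; right; exists u, v; split => //; left; apply: chain_refl.
  by right; left; apply: chain_step xu Bv uv.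
- by right; right; exists b, a; split => //; apply: Qstep au ABv uv.
Qed.

Lemma thin_bigcup (I : Type) (s : seq I) (F : I -> set 'rV[R]_l) :
  (forall i, thin (F i)) -> thin [set z | has (fun i => `[< F i z >]) s].
Proof.
move=> tF; elim: s => [|i s IH]; first exact: thin_subset thin0.
apply: thin_subset (thin_union (tF i) IH) => z /= /orP[/asboolP Fi|hs]; first by left.
by right.
Qed.

Section TotallyDisconnected.
Variables (E : set 'rV[R]_l).
Hypothesis cE : compact E.

Let quasi x := [set y | forall d, 0 < d -> chain E d x y].

(** Passage to the limit as [d] tends to 0: a cluster point of witnesses for [d = 1 / (k + 1)]
    serves, because a witness for a small [d] is one for every larger [d]. *)
Lemma chain_limit (P : R -> set 'rV[R]_l) :
  (forall d, 0 < d -> exists y, E y /\ P d y) ->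
  (forall d d' y, 0 < d <= d' -> P d y -> P d' y) ->
  exists p, E p /\ forall d e, 0 < d -> 0 < e ->
    exists y, [/\ E y, P d y & eucl_dist p y < e].
Proof.
move=> hP Pmono.
have /choice[u uP] : forall k : nat, exists y, E y /\ P k.+1%:R^-1 y.
  by move=> k; apply: hP; rewrite invr_gt0.
have [p [Ep hp]] := cluster_sequence cE (fun k => (uP k).1).
exists p; split => // d e d0 e0.
have [k [Nk pk]] := hp e (Num.trunc d^-1) e0.
exists (u k); split => //; first exact: (uP k).1.
apply: Pmono (uP k).2; rewrite invr_gt0 ltr0n /= invf_ple ?posrE //.
by apply: le_trans (ltW (truncnS_gt _)) _; rewrite ler_nat ltnS.
Qed.

Lemma quasi_closed x p : E p ->
  (forall d e, 0 < d -> 0 < e -> exists y, chain E d x y /\ eucl_dist y p < e) ->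
  quasi x p.
Proof.
move=> Ep h d d0; have [y [xy yp]] := h d d d0 d0.
by apply: chain_step xy Ep (ltW yp).
Qed.

(** Two disjoint closed parts of [quasi x] would lie at distance at least [3 * r]. Fine chains from
    [x] to the second part must leave the [r]-neighbourhood of the first, and a limit of exit points
    would be a point of [quasi x] in neither part. *)
Lemma quasi_connected_aux x D1 D2 : closed D1 -> closed D2 ->
  quasi x `<=` D1 `|` D2 -> quasi x `&` D1 `&` D2 = set0 -> quasi x x -> D1 x ->
  quasi x `<=` D1.
Proof.
move=> clD1 clD2 cover dis Qx D1x y Qy; apply: contrapT => nD1y.
have D2y : D2 y by have [] := cover _ Qy.
pose B1 := quasi x `&` D1; pose B2 := quasi x `&` D2.
have disj p : B1 p -> B2 p -> False.
  by move=> [Qp D1p] [_ D2p]; have : set0 p by rewrite -dis.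
have clos (D : set 'rV[R]_l) p : closed D -> E p ->
    (forall e, 0 < e -> exists b, (quasi x `&` D) b /\ eucl_dist p b < e) ->
    (quasi x `&` D) p.
  move=> clD Ep h; split.
    apply: quasi_closed => // d e d0 e0; have [b [[Qb _] pb]] := h e e0.
    by exists b; split; [exact: Qb | rewrite eucl_distC].
  apply: clD => U /nbhs_eucl[e [e0 eU]]; have [b [[_ Db] pb]] := h e e0.
  by exists b; split => //; apply: eU.
have EQ p : quasi x p -> E p by move=> /(_ 1 ltr01)/chain_end.
have [r [r0 hr]] : exists r, 0 < r /\ forall b b', B1 b -> B2 b' -> 3 * r <= eucl_dist b b'.
  apply: contrapT => /forallNP nr.
  have [||p [Ep hp]] := @chain_limit
      (fun d b => B1 b /\ exists b', B2 b' /\ eucl_dist b b' < 3 * d).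
  - move=> d d0; have /not_andP[//|/existsNP[b /existsNP[b']]] := nr d.
    move=> /not_implyP[B1b /not_implyP[B2b' /negP]]; rewrite -ltNge => bb'.
    exists b; split; first by apply: EQ; case: B1b.
    by split => //; exists b'.
  - move=> d d' b /andP[d0 dd'] [B1b [b' [B2b' bb']]]; split => //; exists b'; split => //.
    by apply: lt_le_trans bb' _; rewrite ler_pM2l.
  apply: (@disj p); apply: clos => // e e0.
    have [b [_ [B1b _] pb]] := hp e e e0 e0.
    by exists b.
  have e4 : 0 < e / 4 by rewrite divr_gt0.
  have [b [_ [B1b [b' [B2b' bb']]] pb]] := hp (e / 4) (e / 4) e4 e4.
  exists b'; split => //; have := eucl_dist_triangle b p b'; move: bb' pb e0; lra.
pose near z := exists b, B1 b /\ eucl_dist z b < r.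
(* The first point of a chain outside the neighbourhood overshoots it by at most one step; capping
   the step by [r] keeps it within [2 * r] of the first part, hence away from the second. *)
have [||p [Ep hp]] := @chain_limit (fun d p => [/\ chain E d x p, ~ near p &
    exists b, B1 b /\ eucl_dist p b <= r + Num.min d r]).
- move=> d d0.
  have step z : chain E (Num.min d r) x z -> near z \/ exists p, E p /\
      [/\ chain E d x p, ~ near p & exists b, B1 b /\ eucl_dist p b <= r + Num.min d r].
    elim=> [Ex|u v xu [nu|] Ev uv].
    + by left; exists x; split => //; rewrite eucl_distxx.
    + have [nv|nv] := pselect (near v); [by left | right; exists v].
      split => //; split => //.
        apply: chain_le (chain_step xu Ev uv); by rewrite ge_min lexx.
      have [b [B1b ub]] := nu; exists b; split => //.
      by have := eucl_dist_triangle u v b; rewrite (eucl_distC v u); move: uv ub; lra.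
    + by right.
  have dr0 : 0 < Num.min d r by rewrite lt_min d0.
  case: (step y (Qy _ dr0)) => // -[b [B1b yb]].
  have := hr _ _ B1b (conj Qy D2y); rewrite eucl_distC; move: yb r0; lra.
- move=> d d' p /andP[d0 dd'] [xp np [b [B1b pb]]]; split => //.
    exact: chain_le xp.
  exists b; split => //; apply: le_trans pb _; rewrite lerD2l.
  by rewrite le_min !ge_min dd' lexx orbT.
have Qp : quasi x p.
  apply: quasi_closed => // d e d0 e0; have [q [_ [xq _ _] pq]] := hp d e d0 e0.
  by exists q; rewrite eucl_distC.
have [q [_ [_ nq [b [B1b qb]]] pq]] := hp r r r0 r0.
have mr : Num.min r r <= r by rewrite ge_min lexx.
case: (cover _ Qp) => Dp.
  by apply: nq; exists p; split => //; rewrite eucl_distC.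
have := hr _ _ B1b (conj Qp Dp); have := eucl_dist_triangle q p b.
rewrite (eucl_distC b p); move: mr qb pq r0; lra.
Qed.

Lemma quasi_connected x : E x -> connected (quasi x).
Proof.
move=> Ex B [b0 Bb0] [C oC BC] [D clD BD].
have Qx : quasi x x by move=> d d0; apply: chain_refl.
have CD p : quasi x p -> (C p <-> D p).
  move=> Qp; have := congr1 (fun S => S p) BC; rewrite BD /= /setI /= => h.
  by split => hp; have := conj Qp hp; [rewrite -h | rewrite h] => -[].
have clC : closed (~` C) by exact: open_closedC.
have b0D : quasi x b0 /\ D b0 by rewrite BD in Bb0.
have [Dx|nDx] := pselect (D x).
  rewrite BD; apply/seteqP; split => p; first by case.
  move=> Qp; split => //; apply: (@quasi_connected_aux x D (~` C)) Qp => //.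
    by move=> q Qq; have [Dq|nDq] := pselect (D q); [left | right => /(CD _ Qq)].
  by rewrite -subset0 => q [[Qq Dq]] nCq; apply: nCq; apply/(CD _ Qq).
exfalso.
have := @quasi_connected_aux x (~` C) D clC clD _ _ Qx _ b0 b0D.1.
apply.
- by move=> q Qq; have [Dq|nDq] := pselect (D q); [right | left => /(CD _ Qq)].
- by rewrite -subset0 => q [[Qq nCq] Dq]; apply: nCq; apply/(CD _ Qq).
- by move/(CD _ Qx).
- by apply/(CD _ b0D.1); exact: b0D.2.
Qed.

(** Points joined by chains of arbitrarily small steps lie in one connected component, so they
    coincide. Compactness turns this into a bound on chains from each point, then into a uniform
    bound. *)
Lemma totally_disconnected_thin : totally_disconnected E -> thin E.
Proof.
move=> tdE e e0.
have loc x : E x -> exists d, 0 < d /\ forall y, chain E d x y -> eucl_dist x y <= e / 2.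
  move=> Ex; apply: contrapT => /forallNP nd.
  have [||p [Ep hp]] := @chain_limit (fun d y => chain E d x y /\ e / 2 < eucl_dist x y).
  - move=> d d0; have /not_andP[//|/existsNP[y /not_implyP[xy /negP]]] := nd d.
    by rewrite -ltNge => h; exists y; split; [exact: chain_end xy|].
  - by move=> d d' y /andP[_ dd'] [xy ?]; split => //; apply: chain_le xy.
  have Qp : quasi x p.
    apply: quasi_closed => // d e' d0 e'0; have [q [_ [xq _] pq]] := hp d e' d0 e'0.
    by exists q; rewrite eucl_distC.
  have : connected_component E x p.
    exists (quasi x) => //; split.
    - by move=> d d0; apply: chain_refl.
    - by move=> q /(_ 1 ltr01)/chain_end.
    - exact: quasi_connected.
  rewrite tdE // => /= px; subst p.
  have e2 : 0 < e / 2 by rewrite divr_gt0.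
  have [q [_ [_ xq] xq']] := hp 1 _ ltr01 e2.
  by move: (lt_trans xq xq'); rewrite ltxx.
apply: contrapT => /forallNP nd.
have [||p [Ep hp]] := @chain_limit
    (fun d x => exists y, chain E d x y /\ e < eucl_dist x y).
- move=> d d0; have /not_andP[//|/existsNP[x /existsNP[y /not_implyP[xy /negP]]]] := nd d.
  by rewrite -ltNge => h; exists x; split; [exact: chain_start xy | exists y].
- by move=> d d' x /andP[_ dd'] [y [xy ?]]; exists y; split => //; apply: chain_le xy.
have [d [d0 hd]] := loc p Ep.
have [x [Ex [y [xy exy]] px]] := hp d d d0 d0.
have px' : chain E d p x by apply: chain_step (chain_refl _ Ep) Ex (ltW px).
have h1 := hd _ px'; have h2 := hd _ (chain_trans px' xy).
have := eucl_dist_triangle p x y; rewrite (eucl_distC x p); move: h1 h2 exy; lra.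
Qed.

End TotallyDisconnected.
End Chains.

(** * Components of cylinders *)

Section Words.
Variables (R : realType) (l m : nat) (r : R).
Variables (S : 'I_m -> 'rV[R]_l -> 'rV[R]_l) (E : set 'rV[R]_l).
Implicit Types (w u v x y : seq 'I_m).

Local Notation Sw := (word_map S).

(* Cylinders of the same level are linked when they lie within distance       *)
(* [r ^+ level], whether or not they meet. Distinct components are then       *)
(* separated by more than [r ^+ level], with no further argument.             *)
Definition touch w u : bool := (size w == size u) &&
  `[< exists p q, [/\ E p, E q & eucl_dist (Sw w p) (Sw u q) <= r ^+ size w] >].

Inductive conn w : seq 'I_m -> Prop :=
| conn_refl : conn w w
| conn_step u v : conn w u -> touch u v -> conn w v.

Definition words k : seq (seq 'I_m) := [seq val t | t <- enum {: k.-tuple 'I_m}].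

Definition component w := [seq u <- words (size w) | `[< conn w u >]].

Definition weight w := size (component w).

(** A canonical word of the component: [component] lists its words in an order that depends on the
    level only. *)
Definition rep w := head w (component w).

(** The components [J] levels further down inside that of [w], each listed once by its
    representative. *)
Definition children (J : nat) w : seq (seq 'I_m) :=
  undup [seq rep (u ++ v) | u <- component w, v <- words J].

Lemma mem_words k w : (w \in words k) = (size w == k).
Proof.
apply/mapP/eqP => [[t _ ->]|wk]; first by rewrite size_tuple.
by move/eqP: wk => wk; exists (Tuple wk) => //; rewrite mem_enum.
Qed.

Lemma words_uniq k : uniq (words k).
Proof. by rewrite map_inj_uniq ?enum_uniq //; exact: val_inj. Qed.

Lemma size_words k : size (words k) = (m ^ k)%N.
Proof. by rewrite size_map -cardE card_tuple card_ord. Qed.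

Lemma word_map_cat u v p : Sw (u ++ v) p = Sw u (Sw v p).
Proof. by elim: u => //= i u IH; rewrite IH. Qed.

Lemma touch_sym w u : touch w u -> touch u w.
Proof.
move=> /andP[/eqP wu /asboolP[p [q [Ep Eq pq]]]]; rewrite /touch wu eqxx /=.
by apply/asboolP; exists q, p; rewrite eucl_distC -wu.
Qed.

Lemma conn_trans u w v : conn w u -> conn u v -> conn w v.
Proof. by move=> wu; elim=> // x y _ wx xy; apply: conn_step wx xy. Qed.

Lemma conn_sym w u : conn w u -> conn u w.
Proof.
elim=> [|x y _ xw xy]; first exact: conn_refl.
by apply: conn_trans xw; apply: conn_step (conn_refl _) (touch_sym xy).
Qed.

Lemma conn_size w u : conn w u -> size u = size w.
Proof. by elim=> // x y _ <- /andP[/eqP]. Qed.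

Lemma mem_comp w u : (u \in component w) <-> conn w u.
Proof.
rewrite mem_filter mem_words; split=> [/andP[/asboolP]//|wu].
by rewrite (conn_size wu) eqxx andbT; apply/asboolP.
Qed.

Lemma comp_uniq w : uniq (component w).
Proof. by rewrite filter_uniq // words_uniq. Qed.

Lemma mem_comp_refl w : w \in component w.
Proof. by apply/mem_comp; exact: conn_refl. Qed.

Lemma weight_gt0 w : (0 < weight w)%N.
Proof. by rewrite /weight; case: (component w) (mem_comp_refl w). Qed.

Lemma comp_conn w u : conn w u -> component w = component u.
Proof.
move=> wu; rewrite /component (conn_size wu); apply: eq_filter => v.
by apply/asboolP/asboolP; apply: conn_trans => //; apply: conn_sym.
Qed.

Lemma weight_conn w u : conn w u -> weight w = weight u.
Proof. by rewrite /weight => /comp_conn->. Qed.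

Lemma conn_rep w : conn w (rep w).
Proof.
apply/mem_comp; rewrite /rep; case: (component w) (mem_comp_refl w) => //= x s _.
exact: mem_head.
Qed.

Lemma rep_conn w u : conn w u -> rep w = rep u.
Proof.
by move=> wu; rewrite /rep (comp_conn wu); case: (component u) (mem_comp_refl u).
Qed.

Lemma rep_eqP w u : rep w = rep u <-> conn w u.
Proof.
split=> [e|]; last exact: rep_conn.
by apply: conn_trans (conn_rep w) _; rewrite e; apply/conn_sym/conn_rep.
Qed.

Lemma rep_rep w : rep (rep w) = rep w.
Proof. by apply/esym/rep_conn/conn_rep. Qed.

Lemma size_rep w : size (rep w) = size w.
Proof. exact/conn_size/conn_rep. Qed.

Lemma weight_rep w : weight (rep w) = weight w.
Proof. exact/esym/weight_conn/conn_rep. Qed.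

Lemma comp_nil : component [::] = [:: [::]].
Proof.
have cnil u : (u \in component [::]) = (u == [::]).
  apply/idP/eqP => [/mem_comp/conn_size/size0nil//|->]; exact: mem_comp_refl.
have := comp_uniq [::]; case: (component [::]) cnil => [|a [|b s]] cnil.
- by have := cnil [::]; rewrite eqxx in_nil.
- by move=> _; have := cnil a; rewrite mem_head => /esym/eqP->.
- have /eqP-> : a == [::] by rewrite -cnil mem_head.
  have /eqP-> : b == [::] by rewrite -cnil inE mem_head orbT.
  by [].
Qed.

Hypothesis r01 : 0 < r < 1.
Hypothesis S_dist : forall i p q, eucl_dist (S i p) (S i q) = r * eucl_dist p q.
Hypothesis E_eq : E = \bigcup_(i in [set: 'I_m]) (S i @` E).

Lemma word_map_dist w p q : eucl_dist (Sw w p) (Sw w q) = r ^+ size w * eucl_dist p q.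
Proof. by elim: w => [|i w IH] /=; rewrite ?mul1r // S_dist IH mulrA -exprS. Qed.

Lemma word_map_stable w p : E p -> E (Sw w p).
Proof. by elim: w => //= i w IH /IH Ep; rewrite E_eq; exists i => //; exists (Sw w p). Qed.

Lemma word_map_cover k p : E p -> exists w q, [/\ size w = k, E q & p = Sw w q].
Proof.
elim: k p => [|k IH] p Ep; first by exists [::], p.
move: (Ep); rewrite {1}E_eq => -[i _ [q /IH[w [q' [wk Eq' ->]]] <-]].
by exists (i :: w), q'; rewrite /= wk.
Qed.

(** A cylinder lies in that of each prefix, and the threshold for linking grows when letters are
    dropped. *)
Lemma touch_take k w u : (k <= size w)%N -> touch w u -> touch (take k w) (take k u).
Proof.
move=> kw /andP[/eqP wu /asboolP[p [q [Ep Eq pq]]]]; apply/andP; split.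
  by rewrite !size_takel // -?wu.
apply/asboolP; exists (Sw (drop k w) p), (Sw (drop k u) q); split.
- exact: word_map_stable.
- exact: word_map_stable.
rewrite -!word_map_cat !cat_take_drop size_takel //; apply: le_trans pq _.
by case/andP: r01 => r0 r1; rewrite ler_wiXn2l ?ltW.
Qed.

Lemma conn_take k w u : (k <= size w)%N -> conn w u -> conn (take k w) (take k u).
Proof.
move=> kw; elim=> [|x y wx IH xy]; first exact: conn_refl.
by apply: conn_step IH (touch_take _ xy); rewrite (conn_size wx).
Qed.

Lemma touch_cat w u v : touch (w ++ u) (w ++ v) = touch u v.
Proof.
rewrite /touch !size_cat eqn_add2l; congr (_ && _); apply: asbool_equiv_eq.
have rw : 0 < r ^+ size w by case/andP: r01 => r0 _; rewrite exprn_gt0.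
by split=> -[p [q [Ep Eq pq]]]; exists p, q; split => //; move: pq;
  rewrite !word_map_cat word_map_dist exprD ler_pM2l.
Qed.

Lemma conn_cat w u v : conn u v -> conn (w ++ u) (w ++ v).
Proof.
elim=> [|x y _ IH xy]; first exact: conn_refl.
by apply: conn_step IH _; rewrite touch_cat.
Qed.

(** Truncated to the level of [w ++ c], the words linked to [w ++ c ++ x] stay in the component of
    [w ++ c]. They all begin with [w], which [touch_cat] then cancels from every link. *)
Lemma conn_cat_inv w c x y :
  (forall u, conn (w ++ c) u -> take (size w) u = w) ->
  conn (w ++ c ++ x) y -> exists y', y = w ++ y' /\ conn (c ++ x) y'.
Proof.
move=> hw; elim=> [|u v wu [u' [uE cu']] uv].
  by exists (c ++ x); split => //; exact: conn_refl.
have wv : conn (w ++ c ++ x) v by apply: conn_step wu uv.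
have := conn_take (k := (size w + size c)%N) _ wv.
rewrite catA take_size_cat ?size_cat // => /(_ _)/hw.
rewrite leq_addr => /(_ isT).
rewrite take_takel ?leq_addr // => tv.
exists (drop (size w) v).
have vE : v = w ++ drop (size w) v by rewrite -{1}tv cat_take_drop.
split => //; apply: conn_step cu' _.
by rewrite -(touch_cat w) -vE -uE.
Qed.

Lemma mem_children J w x : x \in children J w <->
  [/\ rep x = x, size x = (size w + J)%N & conn w (take (size w) x)].
Proof.
rewrite mem_undup; split.
  move=> /allpairsP[[u v] /= [/mem_comp wu]]; rewrite mem_words => /eqP vJ ->.
  split; first exact: rep_rep.
    by rewrite size_rep size_cat vJ (conn_size wu).
  apply: (conn_trans wu); rewrite -(conn_size wu).
  have := conn_take (k := size u) _ (conn_rep (u ++ v)); rewrite take_size_cat //.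
  by apply; rewrite size_cat leq_addr.
move=> [xr xs wx]; apply/allpairsP; exists (take (size w) x, drop (size w) x) => /=.
split; first exact/mem_comp.
  by rewrite mem_words size_drop xs addKn.
by rewrite cat_take_drop xr.
Qed.

Lemma children_uniq J w : uniq (children J w).
Proof. exact: undup_uniq. Qed.

Lemma rep_children J w u v : conn w u -> size v = J -> rep (u ++ v) \in children J w.
Proof.
move=> wu vJ; rewrite mem_undup; apply/allpairsP; exists (u, v) => /=; split => //.
  exact/mem_comp.
by rewrite mem_words vJ.
Qed.

(** Both sides count the words that extend by [J] letters a word of the component; a component met
    by these words consists of such words, since truncation preserves links. *)
Lemma sum_weight_children J w :
  sumn (map weight (children J w)) = (m ^ J * weight w)%N.
Proof.
set L := [seq u ++ v | u <- component w, v <- words J].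
have LE : [seq rep (u ++ v) | u <- component w, v <- words J] = map rep L.
  by rewrite /L map_allpairs.
have uL : uniq L.
  rewrite allpairs_uniq ?comp_uniq ?words_uniq // => -[u v] [u' v'] /=.
  move=> /allpairsP[[a b] /= [/mem_comp au _ [-> ->]]].
  move=> /allpairsP[[a' b'] /= [/mem_comp au' _ [-> ->]]] /eqP.
  by rewrite eqseq_cat ?(conn_size au) ?(conn_size au') // => /andP[/eqP-> /eqP->].
have memL y : y \in L <-> size y = (size w + J)%N /\ conn w (take (size w) y).
  split.
    move=> /allpairsP[[u v] /= [/mem_comp wu]]; rewrite mem_words => /eqP vJ ->.
    by rewrite size_cat vJ (conn_size wu) take_size_cat ?(conn_size wu).
  move=> [ys wy]; apply/allpairsP; exists (take (size w) y, drop (size w) y) => /=.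
  by rewrite cat_take_drop mem_words size_drop ys addKn; split => //; apply/mem_comp.
have cnt x : x \in children J w -> count_mem x (map rep L) = weight x.
  move=> /mem_children[xr xs wx]; rewrite count_map -size_filter; apply: perm_size.
  apply: uniq_perm; [exact: filter_uniq | exact: comp_uniq | move=> y].
  rewrite mem_filter; apply/andP/idP => [[/eqP /= yx _]|/mem_comp xy].
    by apply/mem_comp/rep_eqP; rewrite xr yx.
  split; first by rewrite /= -(rep_conn xy) xr.
  apply/memL; rewrite (conn_size xy); split => //.
  by apply: conn_trans wx (conn_take _ xy); rewrite xs leq_addr.
have := perm_size (perm_count_undup (map rep L)).
rewrite -LE -/(children J w) LE size_flatten /shape -map_comp size_map.
rewrite (_ : size L = m ^ J * weight w)%N; last first.
  by rewrite size_allpairs size_words mulnC.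
move=> <-; congr sumn; apply/eq_in_map => x xc /=.
by rewrite size_nseq cnt.
Qed.

End Words.

(** * Geometry of the self-similar set *)

Section Lattice.
Variables (R : realType) (l : nat) (G : set 'rV[R]_l).
Hypothesis hG : discrete_subgroup G.

Lemma subgroup0 : G 0. Proof. by case: hG. Qed.

Lemma subgroupB a b : G a -> G b -> G (a - b).
Proof. by case: hG => _ + _; apply. Qed.

Lemma subgroupD a b : G a -> G b -> G (a + b).
Proof.
move=> Ga Gb; rewrite -[b]opprK; apply: subgroupB => //.
by rewrite -sub0r; apply: subgroupB => //; exact: subgroup0.
Qed.

Lemma subgroup_natmul k a : G a -> G (k%:R *: a).
Proof.
move=> Ga; elim: k => [|k IH]; first by rewrite scale0r; exact: subgroup0.
by rewrite -natr1 scalerDl scale1r; apply: subgroupD.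
Qed.

Lemma discrete_gap : exists e : R, 0 < e /\ forall a, G a -> eucl_norm a < e -> a = 0.
Proof.
have [_ _ /(_ _ subgroup0) [_ isoV]] := hG; case: isoV => V nV VG.
have [e [e0 eV]] := (nbhs_eucl _ _).1 nV.
exists e; split => // a Ga ae.
have Va : V a by apply: eV; rewrite eucl_distC -eucl_norm_dist0.
by have : [set (0 : 'rV[R]_l)] a by rewrite -VG.
Qed.

(* Points of [G] in a ball are told apart by the cells of a fine cubic grid.  *)
Lemma discrete_finite_ball (D : R) :
  exists s : seq 'rV[R]_l, forall a, G a -> eucl_norm a <= D -> a \in s.
Proof.
have [e [e0 he]] := discrete_gap.
have [D0|D0] := ltP D 0.
  by exists [::] => a _ aD; have := lt_le_trans (le_lt_trans aD D0) (eucl_norm_ge0 a); rewrite ltxx.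
(* Two points of one cell of side [d] are at Euclidean distance at most [l * d], less than the gap
   [e]. *)
pose d := e / l.+1%:R; have d0 : 0 < d by rewrite divr_gt0.
pose K := Num.trunc ((D + D) / d).
pose q (a : 'rV[R]_l) : {ffun 'I_l -> 'I_K.+1} :=
  [ffun i => inord (Num.trunc ((a ord0 i + D) / d))].
have coord (a : 'rV[R]_l) i : eucl_norm a <= D -> 0 <= a ord0 i + D <= D + D.
  move=> aD; have : `|a ord0 i| <= D.
    apply: le_trans aD; apply: le_trans (normr_le_eucl_norm a).
    rewrite [leRHS]/Num.Def.normr /= mx_normrE.
    by apply/bigmax_geP; right; exists (ord0, i).
  by rewrite ler_norml => /andP[h1 h2]; apply/andP; split; lra.
have qinj a b : G a -> G b -> eucl_norm a <= D -> eucl_norm b <= D -> q a = q b -> a = b.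
  move=> Ga Gb aD bD /ffunP qab; apply/eqP; rewrite -subr_eq0; apply/eqP.
  apply: he; first exact: subgroupB.
  apply: le_lt_trans (eucl_norm_le_normr _) _.
  apply: (@le_lt_trans _ _ (l%:R * d)); last first.
    by rewrite /d mulrCA gtr_pMr // ltr_pdivrMr // mul1r ltr_nat.
  rewrite ler_wpM2l // [leLHS]/Num.Def.normr /= mx_normrE.
  apply: bigmax_le => [|[i0 i] _]; first exact: ltW.
  rewrite /= ord1 !mxE; have := qab i; rewrite !ffunE => /(congr1 val) /=.
  have tK c : eucl_norm c <= D -> (Num.trunc ((c ord0 i + D) / d) < K.+1)%N.
    move=> /(coord c i)/andP[c0 cD].
    by rewrite ltnS; apply: le_truncn; rewrite ler_pM2r // invr_gt0.
  rewrite !inordK ?tK // => tab.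
  have /andP[a0 _] := coord a i aD; have /andP[b0 _] := coord b i bD.
  have /andP[ta1 ta2] := truncn_itv (divr_ge0 a0 (ltW d0)).
  have /andP[tb1 tb2] := truncn_itv (divr_ge0 b0 (ltW d0)).
  rewrite tab in ta1 ta2; rewrite -natr1 in ta2 tb2.
  rewrite -[leRHS]mul1r -ler_pdivrMr // -[d in _ / d]gtr0_norm // -normf_div ler_norml.
  have -> : (a ord0 i - b ord0 i) / d = (a ord0 i + D) / d - (b ord0 i + D) / d.
    by rewrite -mulrBl opprD addrACA subrr addr0.
  by apply/andP; split; lra.
have /choice[pk pkP] : forall f : {ffun 'I_l -> 'I_K.+1}, exists a,
    (exists b, [/\ G b, eucl_norm b <= D & q b = f]) ->
    [/\ G a, eucl_norm a <= D & q a = f].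
  move=> f; have [[b h]|nh] := pselect (exists b, [/\ G b, eucl_norm b <= D & q b = f]).
    by exists b.
  by exists 0.
exists [seq pk f | f <- enum {: {ffun 'I_l -> 'I_K.+1}}] => a Ga aD.
apply/mapP; exists (q a); first by rewrite mem_enum.
have [|G' D' q'] := pkP (q a); first by exists a.
exact: qinj.
Qed.

End Lattice.

(** * A compact ambient space for the graph-directed sets *)

Section SupBall.
Variables (R : realType) (l : nat).

(** Graph-directed sets live in a compact space that every edge map sends into itself. A cube
    serves, with the Euclidean distance so that edge maps are exact similitudes. *)
Definition sup_ball (rho : R) : Type := {x : 'rV[R]_l | `|x| <= rho}.

Definition SupBall (rho : R) (x : 'rV[R]_l) (h : `|x| <= rho) : sup_ball rho :=
  exist _ x h.

HB.instance Definition _ (rho : R) := Choice.copy (sup_ball rho)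
  {x : 'rV[R]_l | `|x| <= rho}.

Definition sup_ball_dist (rho : R) (x y : sup_ball rho) : R :=
  eucl_dist (val x) (val y).

Lemma sup_ball_distxx rho (x : sup_ball rho) : sup_ball_dist x x = 0.
Proof. exact: eucl_distxx. Qed.

Lemma sup_ball_dist_eq rho (x y : sup_ball rho) : sup_ball_dist x y = 0 -> x = y.
Proof. by move=> /eucl_dist0_eq/val_inj. Qed.

Lemma sup_ball_distC rho (x y : sup_ball rho) : sup_ball_dist x y = sup_ball_dist y x.
Proof. exact: eucl_distC. Qed.

Lemma sup_ball_dist_triangle rho (y x z : sup_ball rho) :
  sup_ball_dist x z <= sup_ball_dist x y + sup_ball_dist y z.
Proof. exact: eucl_dist_triangle. Qed.

HB.instance Definition _ (rho : R) := isMetric.Build R (sup_ball rho)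
  (@sup_ball_distxx rho) (@sup_ball_dist_eq rho) (@sup_ball_distC rho)
  (@sup_ball_dist_triangle rho).

Lemma sup_ball_compact (rho : R) (A : set 'rV[R]_l) : compact A ->
  A `<=` [set x | `|x| <= rho] -> compact [set x : sup_ball rho | A (val x)].
Proof.
move=> cA Arho F PF FA.
have [p [Ap clp]] := cA (val @ F) _ FA.
pose q : sup_ball rho := SupBall (Arho p Ap).
exists q; split => // B U FB /nbhs_ballP[e /= e0 eU].
have [||_ [[y By <-] py]] := clp (val @` B) [set y | eucl_dist p y < e].
- by rewrite /fmap /=; apply: filterS FB => y By; exists y.
- by apply/nbhs_eucl; exists e.
by exists y; split => //; apply: eU; rewrite ballEmdist.
Qed.

Lemma isometry_continuous (h : 'rV[R]_l -> 'rV[R]_l) :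
  (forall u v, eucl_dist (h u) (h v) = eucl_dist u v) -> continuous h.
Proof.
move=> hiso x U /nbhs_eucl[e [e0 eU]]; apply/nbhs_eucl; exists e; split => // y xy.
by apply: eU; rewrite hiso.
Qed.

Lemma sup_ball_setT_compact (rho : R) : compact [set: sup_ball rho].
Proof.
have := @sup_ball_compact rho [set x | `|x| <= rho].
rewrite (_ : [set x : sup_ball rho | _] = setT); last first.
  by apply/seteqP; split => // -[x hx] _.
apply => //; apply: bounded_closed_compact.
  exists rho; split; first exact: num_real.
  by move=> M rM x /= xr; apply: le_trans xr (ltW rM).
move=> x clx; apply/ler_addgt0Pr => e e0 /=.
have [|y [yrho xy]] := clx [set y | eucl_dist x y < e].
  by apply/nbhs_eucl; exists e.
rewrite -(subrK y x) addrC; apply: le_trans (ler_normD _ _) _; apply: lerD => //.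
by apply: le_trans (normr_le_eucl_norm _) (ltW _).
Qed.

End SupBall.

(** * Cylinders as lattice copies of the attractor *)

Section Geometry.
Variables (R : realType) (l n m : nat) (hn : (2 <= n)%N).
Variables (G : set 'rV[R]_l) (hG : discrete_subgroup G).
Variables (GG : set (G -> G)) (hGG : finite_isometric_group GG).
Variables (ext : (G -> G) -> {linear 'rV[R]_l -> 'rV[R]_l}).
Hypothesis hext : linear_isometric_extension GG ext.
Variables (g : 'I_m -> G -> G) (hg : forall i, GG (g i)).
Variables (b : 'I_m -> 'rV[R]_l) (hb : forall i, G (b i)).
Variable S : 'I_m -> 'rV[R]_l -> 'rV[R]_l.
Hypothesis hS : forall i x, S i x = n%:R^-1 *: ext (g i) x + b i.
Variables (E : set 'rV[R]_l) (hE : self_similar_set S E).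

Local Notation r := (n%:R^-1 : R).
Local Notation Sw := (word_map S).
Local Notation conn := (conn r S E).
Local Notation component := (component r S E).
Local Notation children := (children r S E).

Lemma natr_gt0 : 0 < n%:R :> R.
Proof. by rewrite ltr0n ltnW. Qed.

Lemma ratio_lt1 : 0 < r < 1.
Proof. by rewrite invr_gt0 natr_gt0 invf_lt1 ?natr_gt0 // ltr1n. Qed.

Lemma natrX_neq0 k : n%:R ^+ k != 0 :> R.
Proof. by rewrite expf_neq0 // lt0r_neq0 // natr_gt0. Qed.

Lemma ext_dist h x y : GG h -> eucl_dist (ext h x) (ext h y) = eucl_dist x y.
Proof. by move=> Gh; case: hext => iso _ _; rewrite /eucl_dist -linearB iso. Qed.

Lemma ext_norm h x : GG h -> eucl_norm (ext h x) = eucl_norm x.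
Proof. by move=> Gh; case: hext => iso _ _; rewrite iso. Qed.

Lemma ext_stable h a : GG h -> G a -> G (ext h a).
Proof.
move=> Gh Ga; case: hext => _ he _.
have := he h Gh (SigSub (mem_set Ga)); rewrite /= => ->.
exact: set_valP.
Qed.

Lemma ext_comp h h' x : GG h -> GG h' -> ext (h \o h') x = ext h (ext h' x).
Proof. by move=> Gh Gh'; case: hext => _ _ ->. Qed.

(** [ext id] is idempotent by multiplicativity and injective as an isometry. *)
Lemma ext_id x : ext id x = x.
Proof.
have Gid : GG id by case: hGG => _ [].
apply: eucl_dist0_eq; rewrite -(ext_dist _ _ Gid) -ext_comp //.
exact: eucl_distxx.
Qed.

Lemma self_similar_dist i p q : eucl_dist (S i p) (S i q) = r * eucl_dist p q.
Proof.
by rewrite !hS eucl_distDr eucl_distZ ext_dist // ger0_norm // invr_ge0.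
Qed.

Lemma self_similar_eq : E = \bigcup_(i in [set: 'I_m]) (S i @` E).
Proof. by case: hE. Qed.

Definition word_rot (w : seq 'I_m) : G -> G := foldr (fun i f => g i \o f) id w.

(** Translation part of [n ^+ size w] times the cylinder map. The scaling clears all denominators,
    so it is a lattice point. *)
Fixpoint word_shift (w : seq 'I_m) : 'rV[R]_l :=
  if w is i :: w' then ext (g i) (word_shift w') + n%:R ^+ size w *: b i else 0.

Lemma word_rot_group w : GG (word_rot w).
Proof.
by case: hGG => _ [h1 h2 _] _ _; elim: w => //= i w IH; apply: h2.
Qed.

Lemma word_shift_lattice w : G (word_shift w).
Proof.
elim: w => [|i w IH] /=; first exact: (subgroup0 hG).
apply: (subgroupD hG); first by apply: ext_stable.
by rewrite -natrX; apply: (subgroup_natmul hG).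
Qed.

Lemma word_mapE w p :
  Sw w p = r ^+ size w *: (ext (word_rot w) p + word_shift w).
Proof.
elim: w => [|i w IH] /=; first by rewrite scale1r addr0 ext_id.
rewrite IH hS ext_comp //; last exact: word_rot_group.
rewrite linearZ /= linearD /= scalerA -exprS addrA [in RHS]scalerDr scalerA.
congr (_ + _); rewrite -exprMn mulVf ?expr1n ?scale1r //.
exact/lt0r_neq0/natr_gt0.
Qed.

Lemma scaled_word_map w p :
  n%:R ^+ size w *: Sw w p = ext (word_rot w) p + word_shift w.
Proof. by rewrite word_mapE scalerA exprVn mulfV ?natrX_neq0 ?scale1r. Qed.

Lemma word_shift_inj (hover : ~ complete_overlaps S) w u : size w = size u ->
  word_rot w = word_rot u -> word_shift w = word_shift u -> w = u.
Proof.
move=> swu gwu vwu; apply: contrapT => wu; apply: hover; exists w, u.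
have wn : w != [::] by apply/eqP => w0; move: swu wu; rewrite w0 => /esym/size0nil->.
split => //; last by move=> p; rewrite !word_mapE swu gwu vwu.
  by apply: contraNN wn => /eqP u0; rewrite -size_eq0 swu u0.
exact/eqP.
Qed.

Lemma exprn_unbounded (x : R) : exists k : nat, x <= n%:R ^+ k.
Proof.
exists (Num.trunc x).+1; apply: le_trans (ltW (truncnS_gt x)) _.
by rewrite -natrX ler_nat ltnW // ltn_expl.
Qed.

Lemma self_similar_bounded : exists D : R, 0 < D /\ forall x, E x -> eucl_norm x <= D.
Proof. by apply: compact_eucl_bounded; case: hE. Qed.

Let lattice_pieces : set 'rV[R]_l :=
  [set x | exists h a p, [/\ GG h, G a, E p & x = ext h p + a]].

(* By periodicity a chain may be assumed to start near the origin. While it   *)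
(* stays in a bounded region, it lies in finitely many pieces, whose union is *)
(* totally disconnected.                                                      *)
Lemma lattice_chain_bounded : totally_disconnected E ->
  exists d, 0 < d /\ forall x y, chain lattice_pieces d x y -> eucl_dist x y <= 1.
Proof.
move=> tdE.
have tE : thin E by apply: totally_disconnected_thin => //; case: hE.
have [D [D0 ED]] := self_similar_bounded.
have [s sP] := discrete_finite_ball hG (D + D + 2).
have [hs hsP] : exists hs : seq (G -> G), GG = [set` hs].
  by apply/finite_seqP; case: hGG.
pose piece (ha : (G -> G) * 'rV[R]_l) : set 'rV[R]_l :=
  [set x | GG ha.1 /\ exists p, E p /\ x = ext ha.1 p + ha.2].
have tpiece ha : thin (piece ha).
  have [Gh|nGh] := pselect (GG ha.1); last by apply: (thin_subset _ (@thin0 R l)) => x [].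
  have tiso : thin ((fun p => ext ha.1 p + ha.2) @` E).
    by apply: thin_isometry => // u v; rewrite eucl_distDr ext_dist.
  by apply: (thin_subset _ tiso) => x [_ [p [Ep ->]]]; exists p.
pose L := [seq (h, a) | h <- hs, a <- s].
pose F := [set z | has (fun ha => `[< piece ha z >]) L].
have tF : thin F := thin_bigcup L tpiece.
have [d [d0 d1 hd]] := thin_small tF ltr01.
exists d; split => // x y xy.
have [h [a [p [Gh Ga Ep xE]]]] := chain_start xy.
have xy' : chain lattice_pieces d (x + - a) (y + - a).
  apply: (@chain_map _ _ (fun z => z + - a)) xy => [z [h' [a' [p' [? ? ? ->]]]]|u v].
    by exists h', (a' - a), p'; split => //; [exact: (subgroupB hG) | rewrite addrA].
  by rewrite eucl_distDr.
rewrite -(eucl_distDr (- a)).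
suff : chain F d (x + - a) (y + - a) by exact: hd.
have inF z : lattice_pieces z -> eucl_norm z <= D + 2 -> F z.
  move=> [h' [a' [p' [Gh' Ga' Ep' zE]]]] zD; apply/hasP; exists (h', a'); last first.
    by apply/asboolP; split => //; exists p'.
  apply/allpairsP; exists (h', a'); split => //=.
    by have : [set` hs] h' by rewrite -hsP.
  apply: sP => //; have -> : a' = z + - ext h' p' by rewrite zE addrC addKr.
  apply: le_trans (ler_eucl_normD _ _) _; rewrite eucl_normN ext_norm //.
  by have := ED _ Ep'; move: zD; lra.
have xD : eucl_norm (x + - a) <= D by rewrite xE addrK ext_norm // ED.
(* The part of the chain already in [F] stays within 1 of a point of norm at most [D], and a step is
   at most 1: the next point has norm at most [D + 2] and lies in [F] too. *)
elim: xy' => [Hx|u v _ xu Hv uv].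
  by apply: chain_refl; apply: (inF _ Hx); move: xD; lra.
apply: (chain_step xu _ uv); apply: (inF _ Hv).
have h1 := hd _ _ xu; have := eucl_dist_triangle (x + - a) v 0.
have := eucl_dist_triangle u v (x + - a).
rewrite -!eucl_norm_dist0 (eucl_distC v u) (eucl_distC u (x + - a)).
move: h1 uv xD d1; lra.
Qed.

(** Magnified by [n ^+ k] with [k = size w - j], the links of a component become steps of length at
    most [d] between lattice copies of [E], so the magnified component is bounded. *)
Lemma component_diameter : totally_disconnected E ->
  exists c : R, 0 < c /\ forall w u p q, conn w u -> E p -> E q ->
    eucl_dist (Sw w p) (Sw u q) <= c * r ^+ size w.
Proof.
move=> tdE; have [d [d0 hd]] := lattice_chain_bounded tdE.
have [D [D0 ED]] := self_similar_bounded.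
have E_dist p q : E p -> E q -> eucl_dist p q <= D + D.
  move=> Ep Eq; apply: le_trans (ler_eucl_normD _ _) _.
  by rewrite eucl_normN lerD // ED.
(* In units of [r ^+ size w], base points of linked cylinders are at most two diameters and one link
   apart; [j] levels of refinement make this at most [d]. Lower levels are covered by the diameter
   of [E]. *)
have [j hj] := exprn_unbounded ((D + D + D + D + 1) / d).
have /andP[r0 r1] := ratio_lt1.
have S_dist := self_similar_dist; have E_eq := self_similar_eq.
have rn k : r ^+ k * n%:R ^+ k = 1 by rewrite exprVn mulVf ?natrX_neq0.
have rk k : 0 < r ^+ k by rewrite exprn_gt0.
have nk k : 0 < n%:R ^+ k :> R by rewrite exprn_gt0 // natr_gt0.
have [e0 Ee0] : exists p, E p by case: hE.
exists ((D + D + D + D + 1) * n%:R ^+ j + (D + D + D + D)).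
split; first by rewrite !addr_gt0 // mulr_gt0 // !addr_gt0.
move=> w u p q wu Ep Eq.
have [jw|jw] := leqP j (size w); last first.
  have : eucl_dist (Sw w p) (Sw u q) <= D + D.
    by apply: E_dist; apply: word_map_stable.
  move/le_trans; apply.
  have : (D + D) * 1 <= (D + D) * (n%:R ^+ j * r ^+ size w).
    rewrite ler_pM2l ?addr_gt0 // -[leLHS](rn j) [leLHS]mulrC ler_pM2l //.
    by rewrite ler_wiXn2l ?ltW // ltnW.
  have := mulr_gt0 (nk j) (rk (size w)); have := rk (size w).
  by move: D0; set a := r ^+ _; set c := n%:R ^+ _; nra.
pose k := (size w - j)%N.
have wk : size w = (k + j)%N by rewrite subnK.
have inL v p' : size v = size w -> E p' -> lattice_pieces (n%:R ^+ k *: Sw v p').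
  move=> vw Ep'; have kv : size (take k v) = k by rewrite size_takel // vw leq_subr.
  rewrite -(cat_take_drop k v) word_map_cat -{1}kv scaled_word_map.
  exists (word_rot (take k v)), (word_shift (take k v)), (Sw (drop k v) p').
  split => //; [exact: word_rot_group | exact: word_shift_lattice |].
  exact: (word_map_stable E_eq).
have big : chain lattice_pieces d (n%:R ^+ k *: Sw w e0) (n%:R ^+ k *: Sw u e0).
  elim: wu => [|x y wx IH xy]; first by apply: chain_refl; apply: inL.
  have sx := conn_size wx.
  have sy : size y = size x by case/andP: xy => /eqP.
  apply: (chain_step IH (inL _ _ _ _)) => //; first by rewrite sy.
  move: xy => /andP[_ /asboolP[p' [q' [Ep' Eq' pq']]]].
  rewrite eucl_distZ gtr0_norm //.
  have t1 : eucl_dist (Sw x e0) (Sw x p') <= r ^+ size x * (D + D).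
    by rewrite (word_map_dist S_dist) ler_pM2l // E_dist.
  have t2 : eucl_dist (Sw y q') (Sw y e0) <= r ^+ size x * (D + D).
    by rewrite (word_map_dist S_dist) sy ler_pM2l // E_dist.
  have t3 : eucl_dist (Sw x e0) (Sw y e0) <= r ^+ size x * (D + D + D + D + 1).
    have := eucl_dist_triangle (Sw x p') (Sw x e0) (Sw y e0).
    have := eucl_dist_triangle (Sw y q') (Sw x p') (Sw y e0).
    by move: t1 t2 pq'; set a := r ^+ _; lra.
  rewrite -ler_pdivlMl //; apply: le_trans t3 _.
  rewrite sx wk exprD -mulrA exprVn ler_pM2l ?invr_gt0 //.
  move: hj; rewrite ler_pdivrMr // => hj.
  by rewrite exprVn mulrC ler_pdivrMr // mulrC.
have := hd _ _ big; rewrite eucl_distZ gtr0_norm // -ler_pdivlMl // mulr1 => h1.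
have h2 : eucl_dist (Sw w e0) (Sw u e0) <= n%:R ^+ j * r ^+ size w.
  apply: le_trans h1 _; rewrite wk exprD mulrCA [n%:R ^+ j * _]mulrC rn mulr1.
  by rewrite exprVn.
have t1 : eucl_dist (Sw w p) (Sw w e0) <= r ^+ size w * (D + D).
  by rewrite (word_map_dist S_dist) ler_pM2l // E_dist.
have t2 : eucl_dist (Sw u e0) (Sw u q) <= r ^+ size w * (D + D).
  by rewrite (word_map_dist S_dist) (conn_size wu) ler_pM2l // E_dist.
have := eucl_dist_triangle (Sw w e0) (Sw w p) (Sw u q).
have := eucl_dist_triangle (Sw u e0) (Sw w e0) (Sw u q).
have : 0 < n%:R ^+ j * r ^+ size w by rewrite mulr_gt0.
move: t1 t2 h2 D0 (rk (size w)).
by set a := r ^+ _; set c := n%:R ^+ _; nra.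
Qed.

(** In units of [r ^+ size w], the cylinders of a component differ by bounded lattice vectors and by
    rotations from a finite group. *)
Lemma component_shifts : totally_disconnected E ->
  exists L : seq ((G -> G) * 'rV[R]_l), forall w c, conn w c ->
    (word_rot c, word_shift c - word_shift w) \in L.
Proof.
move=> tdE; have [c0 [c00 hc]] := component_diameter tdE.
have [D [D0 ED]] := self_similar_bounded.
have [s sP] := discrete_finite_ball hG (c0 + D + D).
have [hs hsP] : exists hs : seq (G -> G), GG = [set` hs].
  by apply/finite_seqP; case: hGG.
have [e0 Ee0] : exists p, E p by case: hE.
exists [seq (h, a) | h <- hs, a <- s] => w c wc.
apply/allpairsP; exists (word_rot c, word_shift c - word_shift w); split => //=.
  by have : [set` hs] (word_rot c) by rewrite -hsP; exact: word_rot_group.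
apply: sP; first by apply: (subgroupB hG); exact: word_shift_lattice.
have h1 := hc _ _ _ _ wc Ee0 Ee0.
have nk : 0 < n%:R ^+ size w :> R by rewrite exprn_gt0 // natr_gt0.
have {}h1 : eucl_dist (n%:R ^+ size w *: Sw w e0) (n%:R ^+ size c *: Sw c e0) <= c0.
  rewrite (conn_size wc) eucl_distZ gtr0_norm //.
  by rewrite -ler_pdivlMl // mulrC -exprVn.
rewrite !scaled_word_map /eucl_dist in h1.
set a := ext _ e0 in h1; set a' := ext _ e0 in h1.
have aD : eucl_norm a <= D by rewrite ext_norm ?ED //; exact: word_rot_group.
have aD' : eucl_norm a' <= D by rewrite ext_norm ?ED //; exact: word_rot_group.
have -> : word_shift c - word_shift w =
    - (a + word_shift w - (a' + word_shift c)) + (a - a').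
  by rewrite opprB opprD [RHS]addrC [RHS]addrA [X in _ = X + _]addrA subrK [RHS]addrACA subrr add0r.
apply: le_trans (ler_eucl_normD _ _) _.
have := ler_eucl_normD a (- a'); rewrite !eucl_normN; move: h1 aD aD'; lra.
Qed.

Lemma component_weight_bounded : totally_disconnected E -> ~ complete_overlaps S ->
  exists M, (0 < M)%N /\ forall w, (weight r S E w <= M)%N.
Proof.
move=> tdE hover; have [L LP] := component_shifts tdE.
exists (size L).+1; split => // w; apply: ltnW; rewrite ltnS.
rewrite /weight -(size_map (fun c => (word_rot c, word_shift c - word_shift w))).
apply: uniq_leq_size.
  rewrite map_inj_in_uniq ?comp_uniq // => c c' /mem_comp wc /mem_comp wc' [gE vE].
  apply: word_shift_inj => //; first by rewrite (conn_size wc) (conn_size wc').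
  by move/addIr : vE.
by move=> _ /mapP[c /mem_comp wc ->]; apply: LP.
Qed.

(* The component of [w], rescaled to unit size and translated so that the     *)
(* cylinder of [w] sits at the origin.                                        *)
Definition component_shape (w : seq 'I_m) : set 'rV[R]_l :=
  [set x | exists c p, [/\ conn w c, E p &
     x = ext (word_rot c) p + (word_shift c - word_shift w)]].

Lemma component_shapeP w x : component_shape w x <->
  exists c p, [/\ conn w c, E p & r ^+ size w *: (x + word_shift w) = Sw c p].
Proof.
split=> -[c [p [wc Ep xE]]]; exists c, p; split => //.
  by rewrite xE -addrA subrK word_mapE (conn_size wc).
rewrite addrA -scaled_word_map -xE (conn_size wc) scalerA exprVn mulfV ?natrX_neq0 //.
by rewrite scale1r addrK.
Qed.

Lemma component_shape_nil : component_shape [::] = E.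
Proof.
apply/seteqP; split => [x [c [p [wc Ep ->]]]|x Ex].
  by rewrite (size0nil (conn_size wc)) /= subr0 addr0 ext_id.
by exists [::], x; split => //; [exact: conn_refl | rewrite /= subr0 addr0 ext_id].
Qed.

Lemma component_shape_nonempty w : component_shape w !=set0.
Proof.
have [e0 Ee0] : exists p, E p by case: hE.
by eexists; exists w, e0; split => //; exact: conn_refl.
Qed.

Lemma component_shape_compact w : compact (component_shape w).
Proof.
pose f c p := ext (word_rot c) p + (word_shift c - word_shift w).
have cf c : compact (f c @` E).
  apply: continuous_compact; last by case: hE.
  apply: continuous_subspaceT; apply: isometry_continuous => u v.
  by rewrite eucl_distDr ext_dist //; exact: word_rot_group.
have cs (s : seq (seq 'I_m)) : compact [set x | exists c, c \in s /\ (f c @` E) x].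
  elim: s => [|c s IH].
    rewrite (_ : [set x | _] = set0); first exact: compact0.
    by rewrite -subset0 => x [c []].
  rewrite (_ : [set x | _] = (f c @` E) `|` [set x | exists c, c \in s /\ (f c @` E) x]).
    by apply: compactU.
  apply/seteqP; split => [x [c' []]|x []].
  - by rewrite inE => /orP[/eqP-> | c's] fx; [left | right; exists c'].
  - by move=> fx; exists c; rewrite mem_head.
  - by move=> [c' [c's fx]]; exists c'; rewrite inE c's orbT.
have := cs (component w); rewrite (_ : [set x | _] = component_shape w) //.
apply/seteqP; split => [x [c [/mem_comp wc [p Ep <-]]]|x [c [p [wc Ep ->]]]].
  by exists c, p.
by exists c; split; [exact/mem_comp | exists p].
Qed.

(** This is the graph-directed equation. The child is normalised at its own word, one level finer,
    whence the translation by the difference of shifts with that of [w] multiplied by [n]. *)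
Lemma component_shape_children w x : component_shape w x <->
  exists u z, [/\ u \in children 1%N w, component_shape u z &
    x = r *: (z + (word_shift u - n%:R *: word_shift w))].
Proof.
have r01 := ratio_lt1; have E_eq := self_similar_eq.
have n0 : n%:R != 0 :> R by rewrite lt0r_neq0 // natr_gt0.
split=> [/component_shapeP[c [p [wc Ep xE]]]|[u [z [/(mem_children r01 E_eq)[_ su wu] zu xE]]]].
  have [i1 [q [si Eq pE]]] := word_map_cover E_eq 1 Ep.
  exists (rep r S E (c ++ i1)), (n%:R *: x + n%:R *: word_shift w - word_shift (rep r S E (c ++ i1))).
  split; first exact: rep_children.
    apply/component_shapeP; exists (c ++ i1), q; split => //.
      by apply/conn_sym/conn_rep.
    rewrite subrK -scalerDr size_rep size_cat si addn1 exprSr scalerA -mulrA mulVf // mulr1.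
    by rewrite (conn_size wc) xE word_map_cat pE.
  rewrite addrA subrK addrK scalerA mulVf ?scale1r //.
have [c [p [uc Ep zE]]] := (component_shapeP _ _).1 zu.
apply/component_shapeP.
have sc : (size w <= size u)%N by rewrite su leq_addr.
exists (take (size w) c), (Sw (drop (size w) c) p); split.
- exact: (conn_trans wu) (conn_take r01 E_eq sc uc).
- exact: (word_map_stable E_eq).
rewrite -word_map_cat cat_take_drop -zE xE su addn1 exprSr -scalerA.
congr (_ *: _); rewrite scalerDr scalerBr scalerA mulVf // scale1r.
by rewrite -addrA subrK scalerDr.
Qed.

(** A common point puts two cylinders at distance 0, so they are linked and lie in one component. *)
Lemma children_disjoint w u u' z z' : u \in children 1%N w -> u' \in children 1%N w ->
  component_shape u z -> component_shape u' z' ->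
  z + word_shift u = z' + word_shift u' -> u = u'.
Proof.
have r01 := ratio_lt1; have E_eq := self_similar_eq.
move=> /(mem_children r01 E_eq)[ru su _] /(mem_children r01 E_eq)[ru' su' _].
move=> /component_shapeP[c [p [uc Ep zE]]] /component_shapeP[c' [p' [uc' Ep' zE']]] zz'.
rewrite -ru -ru'; apply: rep_conn; apply: (conn_trans uc); apply: conn_trans (conn_sym uc').
apply: conn_step (conn_refl _ _ _ _) _; apply/andP; split.
  by rewrite (conn_size uc) (conn_size uc') su su'.
apply/asboolP; exists p, p'; split => //.
by rewrite -zE -zE' zz' su su' eucl_distxx exprn_ge0 // ltW // (andP r01).1.
Qed.

Lemma self_similar_dust_class (hm : (2 <= m)%N) :
  totally_disconnected E -> ~ complete_overlaps S ->
  dust_class m r (@subset_dist R l E).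
Proof.
move=> tdE hover.
have r01 := ratio_lt1; have E_eq := self_similar_eq.
have [L LP] := component_shifts tdE.
have [c0 [c00 hc0]] := component_diameter tdE.
have [D [D0 ED]] := self_similar_bounded.
have [e0 Ee0] : exists p, E p by case: hE.
(* [key w] records which of the finitely many pieces occur in the component   *)
(* of [w]; the vertices of the graph are the keys, plus one for the root.     *)
pose pair w c := (word_rot c, word_shift c - word_shift w).
pose key w : (size L).-tuple bool :=
  map_tuple (fun f => `[< exists c, conn w c /\ pair w c = f >]) (in_tuple L).
have keyP w u c : key w = key u -> conn w c -> exists c', conn u c' /\ pair u c' = pair w c.
  move=> /(congr1 val) /= /eq_in_map kE wc; have := kE _ (LP _ _ wc) => e.
  have : `[< exists c', conn w c' /\ pair w c' = pair w c >] by apply/asboolP; exists c.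
  by rewrite e => /asboolP.
have pair_mem w u f : key w = key u ->
    f \in map (pair w) (component w) -> f \in map (pair u) (component u).
  move=> kwu /mapP[c /mem_comp wc ->]; have [c' [uc' <-]] := keyP _ _ _ kwu wc.
  by apply/map_f/mem_comp.
have pair_uniq w : uniq (map (pair w) (component w)).
  rewrite map_inj_in_uniq ?comp_uniq // => c c' /mem_comp wc /mem_comp wc' [gE /addIr vE].
  by apply: word_shift_inj => //; rewrite (conn_size wc) (conn_size wc').
have key_weight w u : key w = key u -> weight r S E w = weight r S E u.
  move=> kwu; rewrite /weight -(size_map (pair w)) -[RHS](size_map (pair u)).
  by apply/perm_size/uniq_perm => // f; apply/idP/idP; exact: pair_mem.
have key_shape w u : key w = key u -> component_shape w = component_shape u.
  suff sub w' u' : key w' = key u' -> component_shape w' `<=` component_shape u'.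
    by move=> kwu; apply/seteqP; split; exact: sub.
  move=> kwu x [c [p [wc Ep ->]]]; have [c' [uc' [gE vE]]] := keyP _ _ _ kwu wc.
  by exists c', p; split => //; rewrite gE vE.
pose B := c0 + D; have B0 : 0 < B by rewrite addr_gt0.
have shapeB w z : component_shape w z -> eucl_norm z <= B.
  move=> /component_shapeP[c [p [wc Ep zE]]].
  have rw : 0 < r ^+ size w by rewrite exprn_gt0 // (andP r01).1.
  have := hc0 _ _ _ _ wc Ee0 Ep.
  rewrite -zE [Sw w e0]word_mapE eucl_distZ gtr0_norm // mulrC ler_pM2r // eucl_distDr => h.
  rewrite -(subrK (ext (word_rot w) e0) z); apply: le_trans (ler_eucl_normD _ _) _.
  rewrite ext_norm; last exact: word_rot_group.
  by rewrite /B lerD ?ED // -/(eucl_dist _ _) eucl_distC.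
(* An edge maps a point of norm at most [B] to another such point, so its translation has norm at
   most [n * B + B]. As [n] is at least 2, the cube of radius [rho] is then sent into itself. *)
pose rho := (n%:R + 1) * B.
have n0 := natr_gt0.
have B_rho : B <= rho by rewrite /rho mulrDl mul1r lerDr mulr_ge0 ?ltW.
have shape_rho w z : component_shape w z -> `|z| <= rho.
  by move=> /shapeB zB; apply: le_trans (normr_le_eucl_norm z) (le_trans zB B_rho).
pose p0 := #|{: (size L).-tuple bool}|.
have /choice[pk pkP] : forall t, exists w, (exists w', key w' = t) -> key w = t.
  move=> t; have [[w' <-]|nt] := pselect (exists w', key w' = t); first by exists w'.
  by exists [::].
(* The root [ord0] carries the empty word, whose component is all of [E]. A tuple that is no key
   gets some word, hence still a genuine component. *)
pose Wd (i : 'I_p0.+1) := if unlift ord0 i is Some j then pk (enum_val j) else [::].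
pose tgt w : 'I_p0.+1 := lift ord0 (enum_rank (key w)).
have keyWd w : key (Wd (tgt w)) = key w.
  by rewrite /Wd /tgt liftK enum_rankK; apply: pkP; exists w.
pose edge : finType := {i : 'I_p0.+1 & 'I_(size (children 1%N (Wd i)))}.
pose chw (e : edge) := nth [::] (children 1%N (Wd (tag e))) (tagged e).
have chwP e : chw e \in children 1%N (Wd (tag e)) by exact: mem_nth.
have i0 : 'I_m by exact: (Ordinal (ltnW hm)).
have src_surj i : exists e : edge, tag e = i.
  have : (0 < size (children 1%N (Wd i)))%N.
    have := @rep_children R l m r S E 1 (Wd i) (Wd i) [:: i0] (conn_refl _ _ _ _) (erefl _).
    by case: (children _ _).
  by move=> h; exists (Tagged (fun i => 'I_(size (children 1%N (Wd i)))) (Ordinal h)).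
pose Q := Multigraph (fun e : edge => tgt (chw e)) src_surj.
pose t (e : edge) := word_shift (chw e) - n%:R *: word_shift (Wd (tag e)).
have t_rho e : `|t e| <= rho.
  apply: le_trans (normr_le_eucl_norm _) _.
  have [z zc] := component_shape_nonempty (chw e).
  have : component_shape (Wd (tag e)) (r *: (z + t e)).
    by apply/component_shape_children; exists (chw e), z.
  move=> /shapeB; rewrite eucl_normZ gtr0_norm ?invr_gt0 // ler_pdivrMl // => h.
  have -> : t e = (z + t e) + - z by rewrite addrAC subrr add0r.
  apply: le_trans (ler_eucl_normD _ _) _; rewrite eucl_normN.
  by have := shapeB _ _ zc; rewrite /rho mulrDl mul1r; lra.
have Se_rho (e : edge) (x : sup_ball l rho) : `|r *: (val x + t e)| <= rho.
  rewrite normrZ gtr0_norm ?invr_gt0 // ler_pdivrMl //.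
  apply: le_trans (ler_normD _ _) _.
  have x_rho : `|val x| <= rho by case: x.
  apply: (@le_trans _ _ (rho + rho)); first by rewrite lerD.
  rewrite -mulr2n -[leLHS]mulr_natl ler_wpM2r ?ler_nat //.
  by rewrite mulr_ge0 ?ltW // addr_gt0.
pose Se (e : gedge Q) (x : sup_ball l rho) : sup_ball l rho := SupBall (Se_rho e x).
pose K (i : 'I_(gsize Q).+1) := [set x : sup_ball l rho | component_shape (Wd i) (val x)].
exists Q, (sup_ball l rho : metricType R), Se, K; split.
- split => //.
  + exact: sup_ball_setT_compact.
  + move=> e x y; rewrite /mdist /= /sup_ball_dist /= eucl_distZ eucl_distDr.
    by rewrite gtr0_norm ?invr_gt0.
  + move=> i; split.
      have [z zi] := component_shape_nonempty (Wd i).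
      by exists (SupBall (shape_rho _ _ zi)).
    apply: sup_ball_compact; first exact: component_shape_compact.
    exact: shape_rho.
  move=> i; apply/seteqP; split=> [x /component_shape_children[u [z [uc uz xE]]]|x].
    have uidx : (index u (children 1%N (Wd i)) < size (children 1%N (Wd i)))%N.
      by rewrite index_mem.
    pose e : edge := Tagged (fun i => 'I_(size (children 1%N (Wd i)))) (Ordinal uidx).
    have chE : chw e = u by rewrite /chw /= nth_index.
    exists e => //; exists (SupBall (shape_rho _ _ uz)).
      by rewrite /K /= chE (key_shape _ _ (keyWd u)).
    by apply: val_inj; rewrite /= xE /t chE.
  move=> [e /= <- [y Ky <-]]; apply/component_shape_children.
  exists (chw e), (val y); split => //.
  by move: Ky; rewrite /K /= (key_shape _ _ (keyWd _)).
- move=> i [i1 k1] [i2 k2] /= e1 e2; subst i1 i2 => -[x [[y Ky yx] [y' Ky' y'x]]].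
  set e1 := existT _ i k1 in Ky yx *; set e2 := existT _ i k2 in Ky' y'x *.
  have : r *: (val y + t e1) = r *: (val y' + t e2).
    by have := congr1 val yx; have := congr1 val y'x => /= -> ->.
  have rn0 : r != 0 by rewrite lt0r_neq0 // invr_gt0.
  move=> /(scalerI rn0); rewrite /t !addrA => /addIr zz'.
  have : chw e1 = chw e2.
    apply: children_disjoint zz'; [exact: chwP | exact: (chwP e2) | |].
      by move: Ky; rewrite /K /= (key_shape _ _ (keyWd _)).
    by move: Ky'; rewrite /K /= (key_shape _ _ (keyWd _)).
  move=> /eqP; rewrite nth_uniq ?children_uniq // => /eqP k12.
  by have k12' : k1 = k2 := ord_inj k12; rewrite /e1 /e2 k12'.
- split => //; exists (\col_i (weight r S E (Wd i))%:R); split.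
    by move=> i; rewrite mxE ltr0n weight_gt0.
  apply/colP => i; rewrite !mxE.
  under eq_bigr => j _ do rewrite !mxE -natrM.
  rewrite -natr_sum -natrM; congr (_%:R).
  (* The row of the adjacency matrix groups by target the edges leaving [i]; a target has the weight
     of the child it stands for, since equal keys give equal weights. *)
  transitivity (\sum_(e : edge | tag e == i) weight r S E (chw e))%N.
    rewrite (partition_big (fun e : edge => tgt (chw e)) xpredT) //=.
    apply: eq_bigr => j _; rewrite cardsE -sum1_card big_distrl /=.
    apply: eq_big => [e|e]; first by rewrite unfold_in.
    by rewrite unfold_in mul1n => /andP[_ /eqP <-]; rewrite (key_weight _ _ (keyWd _)).
  rewrite -[RHS](_ : sumn (map (weight r S E) (children 1%N (Wd i))) = _); last first.
    by rewrite sum_weight_children // expn1.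
  have := @sig_big_dep _ 0%N addn 'I_p0.+1 (fun i => 'I_(size (children 1%N (Wd i))))
    (fun j => j == i) (fun _ _ => true)
    (fun j k => weight r S E (nth [::] (children 1%N (Wd j)) k)).
  rewrite big_pred1_eq sumnE big_map (big_nth [::]) big_mkord => ->.
  by apply: eq_bigl => e; rewrite andbT.
have shapeE x : E x -> component_shape [::] x by rewrite component_shape_nil.
exists (fun x : E => SupBall (shape_rho _ _ (shapeE _ (set_valP x)))).
split => //.
have W0 : Wd ord0 = [::] by rewrite /Wd unlift_none.
apply/seteqP; split => [_ [x _ <-]|x]; first by rewrite /K /= W0; exact/shapeE/set_valP.
rewrite /K /= W0 component_shape_nil => Ex; exists (SigSub (mem_set Ex)) => //.
exact: val_inj.
Qed.

End Geometry.

(** * The tree of components *)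

Section MaximalComponent.
Local Open Scope nat_scope.
Variables (R : realType) (l m : nat) (r : R) (m2 : 2 <= m).
Variables (S : 'I_m -> 'rV[R]_l -> 'rV[R]_l) (E : set 'rV[R]_l).
Hypothesis r01 : (0 < r < 1)%R.
Hypothesis S_dist : forall i p q, eucl_dist (S i p) (S i q) = (r * eucl_dist p q)%R.
Hypothesis E_eq : E = \bigcup_(i in [set: 'I_m]) (S i @` E).

Local Notation conn := (conn r S E).
Local Notation component := (component r S E).
Local Notation weight := (weight r S E).
Local Notation rep := (rep r S E).
Local Notation children := (children r S E).

Variable c : seq 'I_m.
Hypothesis c_max : forall w, weight w <= weight c.

(* A translate of a component of maximal size is connected, hence a whole     *)
(* component, so the tree below it repeats the tree below [c].                *)
Lemma maximal_translate v u : conn (v ++ c) u -> take (size v) u = v.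
Proof.
pose T := map (cat v) (component c).
have uT : uniq T by rewrite map_inj_uniq ?comp_uniq // => x y /eqP; rewrite eqseq_cat // => /andP[_ /eqP].
have subT : {subset T <= component (v ++ c)}.
  by move=> _ /mapP[x /mem_comp cx ->]; apply/mem_comp/conn_cat.
have sT : size (component (v ++ c)) <= size T by rewrite size_map; exact: c_max.
have [_ eT] := uniq_min_size uT subT sT.
by move=> /mem_comp; rewrite -eT => /mapP[x _ ->]; rewrite take_size_cat.
Qed.

(* [x] lies in the subtree below a translate, by a nonempty word, of the      *)
(* component of [c]. The nonempty word excludes the root.                     *)
Definition star x : Prop := exists v, [/\ v <> [::], size v + size c <= size x &
  conn (v ++ c) (take (size v + size c) x)].

Lemma star_conn x y : conn x y -> star x -> star y.
Proof.
move=> xy [v [v0 vx cv]]; exists v; split => //; first by rewrite (conn_size xy).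
exact: conn_trans cv (conn_take r01 E_eq vx xy).
Qed.

Lemma star_rep x : star (rep x) <-> star x.
Proof. by split; apply: star_conn; [apply: conn_sym|]; exact: conn_rep. Qed.

Lemma star_children J w x : x \in children J w -> star w -> star x.
Proof.
move=> /(mem_children r01 E_eq)[_ xs wx] [v [v0 vw cv]]; exists v; split => //.
  by rewrite xs (leq_trans vw) ?leq_addr.
apply: (conn_trans cv); have := conn_take r01 E_eq vw wx.
by rewrite take_takel.
Qed.

Lemma not_star_nil : ~ star [::].
Proof. by move=> [[|a v] []]. Qed.

Lemma weight_translate v c1 e : conn c c1 -> weight (v ++ c1 ++ e) = weight (c1 ++ e).
Proof.
move=> cc1; rewrite /weight -(size_map (cat v) (component (c1 ++ e))); apply: perm_size.
apply: uniq_perm; first exact: comp_uniq.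
  by rewrite map_inj_uniq ?comp_uniq // => y z /eqP; rewrite eqseq_cat // => /andP[_ /eqP].
move=> y; apply/idP/mapP => [/mem_comp xy|[z /mem_comp ez ->]]; last exact/mem_comp/conn_cat.
have [u cu|y' [-> ?]] := conn_cat_inv r01 S_dist E_eq _ xy.
  by apply: maximal_translate; apply: conn_trans cu; exact: conn_cat.
by exists y' => //; apply/mem_comp.
Qed.

(** The prefix [v] of a star word can be exchanged for any nonempty word without changing the
    weight, as the tree below a translate of the component of [c] is a copy. *)
Lemma star_tail x : star x -> exists c1 e, [/\ conn c c1, weight x = weight (c1 ++ e) &
  forall v, v <> [::] -> star (v ++ c1 ++ e)].
Proof.
move=> [v [v0 vx cv]].
have tv : take (size v) (take (size v + size c) x) = v by exact: maximal_translate.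
have [c1 [tE cc1]] : exists c1, take (size v + size c) x = v ++ c1 /\ conn c c1.
  have := @conn_cat_inv _ _ _ _ _ _ r01 S_dist E_eq v c [::] (take (size v + size c) x).
  by rewrite cats0; apply; first exact: maximal_translate.
exists c1, (drop (size v + size c) x); split => //.
  by rewrite -(weight_translate v _ cc1) catA -tE cat_take_drop.
move=> v' v'0; exists v'; have sc := conn_size cc1; split => //.
  by rewrite !size_cat sc addnA leq_addr.
by rewrite catA -sc -size_cat take_size_cat //; exact: conn_cat.
Qed.

(** Below any [w], each word [s] of length [J - t] followed by the tail of [x] yields a child of the
    same weight, and there are [m ^ (J - t)] such words. *)
Lemma star_children_count x : star x -> exists t, forall J w, t < J ->
  J - t <= count (fun y => `[< star y >] && (weight y == weight x)) (children J w).
Proof.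
move=> sx; have [c1 [e [cc1 wx hs]]] := star_tail sx.
exists (size (c1 ++ e)) => J w tJ; set t := size (c1 ++ e) in tJ *.
pose y s := rep ((w ++ s) ++ c1 ++ e).
(* All words of such a component begin with [w ++ s], so different [s] give different children. *)
have pre s u : conn ((w ++ s) ++ c1 ++ e) u -> exists u', u = (w ++ s) ++ u'.
  move=> cu; have [u'' h|u' [-> _]] := conn_cat_inv r01 S_dist E_eq _ cu; last by exists u'.
  by apply: maximal_translate; apply: conn_trans h; exact: conn_cat.
apply: (@leq_trans (size (map y (words m (J - t))))).
  by rewrite size_map size_words ltnW // ltn_expl.
rewrite -size_filter; apply: uniq_leq_size.
  rewrite map_inj_in_uniq ?words_uniq // => s s'; rewrite !mem_words => /eqP ss /eqP ss'.
  move=> /rep_eqP/pre[u' /eqP]; rewrite eqseq_cat ?size_cat ?ss ?ss' // => /andP[/eqP + _].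
  by move=> /eqP; rewrite eqseq_cat // => /andP[_ /eqP->].
move=> _ /mapP[s + ->]; rewrite mem_words => /eqP ss.
have s0 : s <> [::] by move=> s0; move: ss tJ; rewrite s0 /=; lia.
have ws0 : w ++ s <> [::] by case: (w).
rewrite mem_filter; apply/andP; split.
  apply/andP; split; first by apply/asboolP/star_rep; exact: hs.
  by rewrite weight_rep wx weight_translate.
apply/(mem_children r01 E_eq); split.
- exact: rep_rep.
- by rewrite size_rep !size_cat ss -/t; move: tJ; rewrite /t size_cat; lia.
- have [u' uE] := pre s _ (conn_rep _ _ _ _).
  by rewrite /y uE -catA take_size_cat //; exact: conn_refl.
Qed.

End MaximalComponent.

(** * The attractor as the set of paths in the tree of components *)

Section AttractorCoding.
Variables (R : realType) (l m : nat) (r : R).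
Variables (S : 'I_m -> 'rV[R]_l -> 'rV[R]_l) (E : set 'rV[R]_l).
Hypothesis r01 : 0 < r < 1.
Hypothesis S_dist : forall i p q, eucl_dist (S i p) (S i q) = r * eucl_dist p q.
Hypothesis E_eq : E = \bigcup_(i in [set: 'I_m]) (S i @` E).
Hypotheses (E0 : E !=set0) (cE : compact E).

Local Notation Sw := (word_map S).
Local Notation conn := (conn r S E).
Local Notation rep := (rep r S E).
Local Notation children := (children r S E).

Lemma expr_small (e : R) : 0 < e -> exists k : nat, r ^+ k < e.
Proof.
move=> e0; have r1 : `|r| < 1 by case/andP: r01 => r0 r1; rewrite gtr0_norm.
have := cvg_expr r1 => /cvgrPdist_lt/(_ _ e0)[N _ hN].
exists N; have := hN N (leqnn N); rewrite /= sub0r normrN => /le_lt_trans; apply.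
exact: ler_norm.
Qed.

(** A point is coded by the nested components containing it. Points in a common component are close
    by the diameter bound, and points in different components are apart because their cylinders are
    not linked. *)
Lemma component_coding (J : nat) (c : R) : (0 < J)%N -> 0 < c ->
  (forall w u p q, conn w u -> E p -> E q ->
     eucl_dist (Sw w p) (Sw u q) <= c * r ^+ size w) ->
  coded_by (@subset_dist R l E) (r ^+ J) (tree_path [::] (children J) [::]).
Proof.
move=> J0 c0 hc; have /andP[r0 r1] := r01.
have rk k : 0 < r ^+ k by rewrite exprn_gt0.
have /choice[wd wdP] : forall xk : E * nat, exists w,
    size w = (xk.2 * J)%N /\ exists q, E q /\ val xk.1 = Sw w q.
  move=> [x k]; have [w [q [wk Eq xE]]] := word_map_cover E_eq (k * J) (set_valP x).
  by exists w; split => //; exists q.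
pose node x k := rep (wd (x, k)).
have sz x k : size (wd (x, k)) = (k * J)%N by have [] := wdP (x, k).
(* Being close to a cylinder, rather than in it, already determines the node. Independence of the
   choice of [wd] follows. *)
have close x y k w q : size w = (k * J)%N -> E q ->
    eucl_dist (val x) (Sw w q) <= r ^+ (k * J) -> y = node x k -> y = rep w.
  move=> wk Eq xw ->; apply: rep_conn; apply: conn_step (conn_refl _ _ _ _) _.
  have [_ [p [Ep xE]]] := wdP (x, k).
  by rewrite /touch sz wk eqxx; apply/asboolP; exists p, q; rewrite -xE.
have nodeE x k w q : size w = (k * J)%N -> E q -> val x = Sw w q -> node x k = rep w.
  by move=> wk Eq xE; apply: (close x _ k w q wk Eq) => //; rewrite xE eucl_distxx ltW.
have sn x k : size (node x k) = (k * J)%N by rewrite size_rep sz.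
have node_take x k w q : size w = (k.+1 * J)%N -> E q -> val x = Sw w q ->
    node x k = rep (take (k * J) w).
  move=> wk Eq xE; have kk : (k * J <= k.+1 * J)%N by rewrite leq_mul2r leqnSn orbT.
  apply: (nodeE x _ _ (Sw (drop (k * J) w) q)); first by rewrite size_takel // wk.
    exact: (word_map_stable E_eq).
  by rewrite -word_map_cat cat_take_drop.
have nodeS x k : node x k = rep (take (k * J) (node x k.+1)).
  have kk : (k * J <= k.+1 * J)%N by rewrite leq_mul2r leqnSn orbT.
  have [_ [p [Ep xE]]] := wdP (x, k.+1).
  rewrite (node_take _ _ _ _ (sz _ _) Ep xE); apply: rep_conn.
  by apply: (conn_take r01 E_eq _ (conn_rep _ _ _ _)); rewrite sz.
have node_child x k : node x k.+1 \in children J (node x k).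
  apply/(mem_children r01 E_eq); split; first exact: rep_rep.
    by rewrite !sn mulSn addnC.
  by apply/rep_eqP; rewrite sn -nodeS /node rep_rep.
have node0 x : node x 0%N = [::].
  by apply: size0nil; rewrite sn.
pose a x k := index (node x k.+1) (children J (node x k)).
have node_atE x k : node_at [::] (children J) [::] (a x) k = node x k.
  by elim: k => [|k IH] /=; rewrite ?node0 // IH nth_index.
have node_agree x y k : agree_below k (a x) (a y) -> node x k = node y k.
  move=> xy; rewrite -!node_atE; elim: k xy => // k IH xy /=.
  by rewrite IH ?xy // => j jk; apply: xy; apply: ltnW.
have up x y k : agree_below k (a x) (a y) -> subset_dist x y <= c * r ^+ (J * k).
  move=> /node_agree/rep_eqP xy.
  have [_ [p [Ep xE]]] := wdP (x, k); have [_ [q [Eq yE]]] := wdP (y, k).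
  rewrite /subset_dist xE yE mulnC -(sz x k); exact: hc.
have rJ : 0 < r ^+ J by [].
(* Codes that differ at index [k] separate only the nodes of level [k.+1], so the lower bound loses
   a factor [r ^+ J]; the upper bound needs [c]. *)
exists a, (c + (r ^+ J)^-1); split.
- by rewrite addr_gt0 ?invr_gt0.
- split=> [x y axy|x]; last exact: eucl_distxx.
  apply/val_inj/eucl_dist0_eq/eqP; rewrite eq_le eucl_dist_ge0 andbT leNgt.
  apply/negP => xy0.
  have [k hk] := expr_small (divr_gt0 xy0 c0).
  move: hk; apply/negP; rewrite -leNgt ler_pdivrMr // mulrC.
  apply: le_trans (up x y k _) _; first by rewrite axy.
  by rewrite ler_pM2l // ler_wiXn2l ?ltW // leq_pmull.
- split=> [x k|p pP]; first by rewrite node_atE index_mem.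
  pose nd k := node_at [::] (children J) [::] p k.
  have ndS k : nd k.+1 \in children J (nd k) by apply: mem_nth; exact: pP.
  have nd_sz k : size (nd k) = (k * J)%N.
    elim: k => // k IH; have /(mem_children r01 E_eq)[_ -> _] := ndS k.
    by rewrite IH mulSn addnC.
  have nd_rep k : rep (nd k) = nd k.
    case: k => [|k]; first by apply: size0nil; rewrite size_rep.
    by have /(mem_children r01 E_eq)[] := ndS k.
  have nd_take k j : conn (nd k) (take (k * J) (nd (k + j)%N)).
    elim: j => [|j IH]; first by rewrite addn0 -nd_sz take_size; exact: conn_refl.
    rewrite addnS; have /(mem_children r01 E_eq)[_ _ wx] := ndS (k + j)%N.
    apply: (conn_trans IH).
    have kj : (k * J <= size (nd (k + j)%N))%N by rewrite nd_sz leq_mul2r leq_addr orbT.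
    have := conn_take r01 E_eq kj wx.
    by rewrite take_takel.
  have [e0 Ee0] := E0.
  (* A cluster point of base points of the nodes of the path: deep nodes come within [r ^+ (k * J)]
     of it, which fixes its node at level [k]. *)
  have [q [Eq hq]] := cluster_sequence cE
    (fun k => word_map_stable E_eq (nd k) Ee0).
  pose x : E := SigSub (mem_set Eq).
  have nodeP k : node x k = nd k.
    have [j [kj xj]] := hq _ k (rk (k * J)%N).
    rewrite -nd_rep (rep_eqP _ _ _ _ (take (k * J) (nd j))).2; last first.
      by rewrite -(subnKC kj); exact: nd_take.
    apply: (close x _ k _ (Sw (drop (k * J) (nd j)) e0)) => //.
    - by rewrite size_takel // nd_sz leq_mul2r kj orbT.
    - exact: (word_map_stable E_eq).
    by rewrite -word_map_cat cat_take_drop ltW.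
  exists x; apply/funext => k; rewrite /a !nodeP.
  by rewrite /nd /= index_uniq ?children_uniq //; exact: pP.
- move=> x y k xy; rewrite -exprM; apply: le_trans (up _ _ _ xy) _.
  by rewrite ler_pM2r // lerDl invr_ge0 ltW.
- move=> x y k axy.
  have nxy : node x k.+1 <> node y k.+1.
    by move=> e; apply: axy; rewrite /a (nodeS x k) (nodeS y k) e.
  have : ~~ touch r S E (wd (x, k.+1)) (wd (y, k.+1)).
    apply/negP => xy; apply: nxy; apply: rep_conn.
    exact: conn_step (conn_refl _ _ _ _) xy.
  rewrite /touch !sz eqxx /= => /asboolPn nt.
  have : r ^+ (k.+1 * J) <= subset_dist x y.
    rewrite leNgt; apply/negP => /ltW xy; apply: nt.
    have [_ [p [Ep xE]]] := wdP (x, k.+1); have [_ [q [Eq yE]]] := wdP (y, k.+1).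
    by exists p, q; split => //; rewrite -xE -yE.
  apply: le_trans; rewrite mulSn exprD [(k * J)%N]mulnC [in leRHS]exprM ler_pM2r ?exprn_gt0 //.
  by rewrite invf_ple ?posrE ?addr_gt0 ?invr_gt0 // lerDr ltW.
Qed.

End AttractorCoding.

(** * The symbolic space as the set of paths in a regular tree *)

Section SymbolicCoding.
Variables (R : realType) (m : nat) (r : R).
Hypothesis r01 : 0 < r < 1.

(** Letters are read in blocks of [J], a block being coded by its position in [words m J]. The term
    [(r ^+ J)^-1] pays for the block in which two sequences first differ. *)
Lemma symbolic_coding (J : nat) : (0 < J)%N ->
  coded_by (@symbolic_dist R m r) (r ^+ J) (tree_path tt (fun _ => nseq (m ^ J) tt) tt).
Proof.
move=> J0; have /andP[r0 r1] := r01.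
have rk k : 0 < r ^+ k by rewrite exprn_gt0.
pose block (x : nat -> 'I_m) k := mkseq (fun j => x (k * J + j)%N) J.
pose a x k := index (block x k) (words m J).
have blockE x k : block x k \in words m J by rewrite mem_words size_mkseq.
have blk x y k : a x k = a y k -> block x k = block y k.
  by move=> e; rewrite -(nth_index [::] (blockE x k)) -/(a x k) e nth_index.
have coord x j : x j = nth (x 0%N) (block x (j %/ J)%N) (j %% J)%N.
  by rewrite nth_mkseq ?ltn_mod // -divn_eq.
have agree_blocks x y k : agree_below k (a x) (a y) ->
    forall j, (j < k * J)%N -> x j = y j.
  move=> xy j jk; have jJ : ((j %/ J) < k)%N by rewrite ltn_divLR.
  rewrite (coord x) (coord y) (blk _ _ _ (xy _ jJ)).
  by apply: set_nth_default; rewrite size_mkseq ltn_mod.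
have diff_blocks x y k : a x k <> a y k -> exists j, (j < k.+1 * J)%N /\ x j <> y j.
  move=> axy; apply: contrapT => /forallNP h; apply: axy; rewrite /a; congr index.
  apply/eq_in_map => j; rewrite mem_iota /= add0n => jJ; apply: contrapT => xyj.
  by apply: (h (k * J + j)%N); split => //; rewrite mulSn addnC ltn_add2r.
have symb x y k : (exists j, (j <= k)%N /\ x j <> y j) -> r ^+ k <= symbolic_dist r x y.
  move=> [j [jk xyj]]; rewrite /symbolic_dist; case: pselect => [ex|]; last first.
    by case; exists j; apply/eqP.
  case: ex_minnP => i _ /(_ j) ij; rewrite ler_wiXn2l ?ltW //.
  by apply: leq_trans (ij _) jk; apply/eqP.
exists a, (1 + (r ^+ J)^-1); split.
- by rewrite addr_gt0 ?invr_gt0.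
- split=> [x y axy|x].
    apply/funext => j; apply: (agree_blocks _ _ j.+1); first by rewrite axy.
    by rewrite (leq_trans (ltnSn j)) // leq_pmulr.
  rewrite /symbolic_dist; case: pselect => // ex.
  by exfalso; case: ex => k; rewrite eqxx.
- split=> [x k|p pP].
    by rewrite size_nseq /a -size_words index_mem.
  have pN k : (p k < size (words m J))%N by rewrite size_words; have := pP k; rewrite size_nseq.
  have wJ k : size (nth [::] (words m J) (p k)) = J.
    by apply/eqP; rewrite -mem_words mem_nth.
  have [i0] : exists i0 : 'I_m, True.
    by have := wJ 0%N; case: (nth _ _ _) => [|i s _]; [move=> /= e; rewrite -e in J0 | exists i].
  move=> _; exists (fun j => nth i0 (nth [::] (words m J) (p (j %/ J)%N)) (j %% J)%N).
  apply/funext => k; rewrite /a -[RHS](@index_uniq _ [::] _ (words m J)) ?words_uniq //.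
  congr index; apply: (@eq_from_nth _ i0); first by rewrite size_mkseq wJ.
  move=> j; rewrite size_mkseq => jJ; rewrite nth_mkseq //.
  by rewrite divnMDl // divn_small // addn0 modnMDl modn_small.
- move=> x y k /agree_blocks xy; rewrite /symbolic_dist; case: pselect => [ex|_]; last first.
    by rewrite mulr_ge0 ?exprn_ge0 ?addr_ge0 ?invr_ge0 // ltW.
  case: ex_minnP => i /eqP xyi _; have ki : (k * J <= i)%N.
    by rewrite leqNgt; apply/negP => /xy.
  apply: (@le_trans _ _ (r ^+ (k * J))); first by rewrite ler_wiXn2l ?ltW.
  by rewrite mulnC exprM ler_peMl ?exprn_ge0 ?lerDl ?invr_ge0 // ltW.
- move=> x y k /diff_blocks[j [jk xyj]].
  have : r ^+ (k.+1 * J) <= symbolic_dist r x y.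
    by apply: symb; exists j; split => //; exact: ltnW.
  apply: le_trans; rewrite mulSn exprD [(k * J)%N]mulnC [in leRHS]exprM ler_pM2r ?exprn_gt0 //.
  by rewrite invf_ple ?posrE ?addr_gt0 ?invr_gt0 // lerDr.
Qed.

End SymbolicCoding.

(** * Regrouping the tree of components into a regular tree *)

Section TreeEquivalence.
Local Open Scope nat_scope.
Variables (R : realType) (l m : nat) (r : R) (m2 : 2 <= m).
Variables (S : 'I_m -> 'rV[R]_l -> 'rV[R]_l) (E : set 'rV[R]_l).
Hypothesis r01 : (0 < r < 1)%R.
Hypothesis S_dist : forall i p q, eucl_dist (S i p) (S i q) = (r * eucl_dist p q)%R.
Hypothesis E_eq : E = \bigcup_(i in [set: 'I_m]) (S i @` E).
Variables (M : nat) (M0 : 0 < M).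

Local Notation weight := (weight r S E).
Local Notation children := (children r S E).
Local Notation star := (star r S E).

Hypothesis weightM : forall w, weight w <= M.

Lemma maximal_component : exists c, forall w, weight w <= weight c.
Proof.
have ex : exists k, `[< exists w, weight w = k >].
  by exists (weight [::]); apply/asboolP; exists [::].
have bd k : `[< exists w, weight w = k >] -> k <= M by move=> /asboolP[w <-].
case: (ex_maxnP ex bd) => k /asboolP[c <-] kmax; exists c => w.
by apply: kmax; apply/asboolP; exists w.
Qed.

Variable c : seq 'I_m.
Hypothesis c_max : forall w, weight w <= weight c.

Lemma star_weight_count (us : seq nat) (B : nat) :
  (forall u, u \in us -> exists x, star c x /\ weight x = u) ->
  exists J0, forall J w, J0 <= J -> forall u, u \in us ->
    B <= count (fun y => `[< star c y >] && (weight y == u)) (children J w).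
Proof.
elim: us => [|u us IH] hus; first by exists 0.
have [|J0 hJ0] := IH; first by move=> v vus; apply: hus; rewrite inE vus orbT.
have [x [sx wx]] := hus u (mem_head _ _).
have [t ht] := star_children_count m2 r01 S_dist E_eq c_max sx.
exists (maxn J0 (t + B).+1) => J w; rewrite geq_max => /andP[JJ tJ] v.
rewrite inE => /orP[/eqP->|vus]; last exact: hJ0.
by rewrite -wx; apply: leq_trans (ht J w _); lia.
Qed.

Lemma unit_seq_perm (s t : seq unit) : size s = size t -> perm_eq s t.
Proof.
by move=> st; rewrite (_ : s = t) //; elim: s t st => [|[] s IH] [|[] t] //= [/IH->].
Qed.

Lemma leq_size_sumn (T : Type) (f : T -> nat) (s : seq T) :
  all (fun x => 0 < f x) s -> size s <= sumn (map f s).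
Proof. by elim: s => //= x s IH /andP[fx /IH]; lia. Qed.

(** The tree on [Z] below is the pivot: forgetting how far units are stretched gives the tree of
    components and units, while [lab2] turns it into a forest of [N]-ary trees. *)
Lemma tree_equiv : exists J, 0 < J /\
  path_equiv (tree_path [::] (children J) [::])
             (tree_path tt (fun=> nseq (m ^ J) tt) tt).
Proof.
pose U u := exists x, star c x /\ weight x = u.
have i0 : 'I_m by exact: (Ordinal (ltnW m2)).
have Uc : U (weight c).
  exists ([:: i0] ++ c); split.
    exists [:: i0]; split => //.
    by rewrite -size_cat take_size; exact: conn_refl.
  have := weight_translate r01 S_dist E_eq c_max [:: i0] [::] (conn_refl r S E c).
  by rewrite !cats0.
have [d [P [Q [d0 PQ hPQ dU]]]] := min_sum_difference Uc (weight_gt0 _ _ _ _).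
pose K := flatten (nseq M P) ++ flatten (nseq M Q).
(* The terms of [B] provide the copies of [K] reserved in exact packing, the margin of slack
   packing, and a unit for each of the at most [2 * M] bins. *)
pose B := M * size K + 2 * M * M + 2 * M.
have [|J0 hJ0] := @star_weight_count (weight c :: P ++ Q) B.
  by move=> u; rewrite inE => /orP[/eqP->//|/hPQ].
pose J := J0 + 2 * sumn K + 2 * M + 1; pose N := m ^ J.
have JN : J < N by exact: ltn_expl.
have N0 : 0 < N by exact: leq_trans JN.
exists J; split; first by rewrite /J addn1.
have cnt w u : u \in weight c :: P ++ Q ->
    B <= count (fun y => `[< star c y >] && (weight y == u)) (children J w).
  by apply: hJ0; rewrite /J; lia.
have dstar x : star c x -> d %| weight x by move=> sx; apply: dU; exists x.
pose stars w := [seq x <- children J w | `[< star c x >]].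
pose others w := [seq x <- children J w | ~~ `[< star c x >]].
have split_children w (T : eqType) (f : seq 'I_m -> T) :
    perm_eq (map f (children J w)) (map f (others w) ++ map f (stars w)).
  by rewrite -map_cat perm_map // perm_sym perm_catC perm_filterC.
have sum_children w : sumn (map weight (others w)) + sumn (map weight (stars w)) = N * weight w.
  by rewrite -sumn_cat -(perm_sumn (split_children w _ weight)) sum_weight_children.
have stars_B w : B <= size (stars w).
  rewrite size_filter; apply: leq_trans (cnt w _ (mem_head _ _)) _.
  by apply: sub_count => y /andP[].
pose units w := sumn [seq weight x %/ d | x <- stars w].
have units_ge w : size (stars w) <= units w.
  apply: leq_size_sumn; apply/allP => x; rewrite mem_filter => /andP[/asboolP sx _].
  by rewrite divn_gt0 // dvdn_leq ?weight_gt0 // dstar.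
have units_le w : units w <= sumn (map weight (stars w)).
  by rewrite /units; elim: (stars w) => //= x s IH; rewrite leq_add // leq_div.
(* the tree in which a star component is replaced by [weight %/ d] units *)
pose lab1 w : seq (option (seq 'I_m)) :=
  if `[< star c w >] then nseq (weight w %/ d) None else [:: Some w].
pose ch1 (u : option (seq 'I_m)) : seq (option (seq 'I_m)) :=
  if u is Some w then flatten (map lab1 (children J w)) else nseq N None.
have ch1E w : perm_eq (ch1 (Some w)) (map Some (others w) ++ nseq (units w) None).
  rewrite /= /units /others /stars; elim: (children J w) => //= x s IH.
  rewrite {1}/lab1; case: ifP => sx /=; last by rewrite perm_cons.
  by rewrite nseqD perm_sym perm_catCA perm_cat2l perm_sym.
have exact_stars w : star c w -> exists gs : seq (seq (seq 'I_m)),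
    [/\ size gs = weight w %/ d, perm_eq (flatten gs) (children J w) &
        all (fun g => sumn (map weight g) == d * N) gs].
  move=> sw; apply: (exact_packing d0 M0 PQ).
  - rewrite sumnE big_seq; apply: dvdn_sum => u uQ.
    by apply: dU; apply: hPQ; rewrite mem_cat uQ orbT.
  - rewrite -/K; apply: leq_trans (leq_pmull _ d0); apply: leq_trans (ltnW JN).
    by rewrite /J; lia.
  - by rewrite divn_gt0 // dvdn_leq ?weight_gt0 // dstar.
  - apply/allP => x xw; rewrite weightM andbT; apply: dstar.
    exact: (star_children r01 E_eq xw).
  - by rewrite sum_weight_children // mulnA divnK ?dstar // mulnC.
  move=> u uPQ; apply: leq_trans (_ : B <= _); last first.
    rewrite count_map; apply: leq_trans (cnt w u _) _; first by rewrite inE uPQ orbT.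
    by apply: sub_count => y /andP[].
  rewrite -/K /B -addnA; apply: leq_trans (leq_addr _ _).
  by rewrite leq_mul2r (leq_trans (leq_div _ _)) ?orbT // weightM.
have E_to_1 : path_equiv (tree_path [::] (children J) [::])
    (forest_path None ch1 (lab1 [::])).
  apply: (@regrouping_equiv _ _ _ _ _ _ _ (fun=> True)) => // w _.
  rewrite /regroups /lab1; case: asboolP => sw; last first.
    by exists [:: children J w]; split => //=; rewrite ?cats0 // => -[].
  have [gs [sgs pgs ags]] := exact_stars w sw.
  exists gs; rewrite size_nseq; split => // j jw; rewrite nth_nseq jw /=.
  have jgs : nth [::] gs j \in gs by rewrite mem_nth // sgs.
  have gstar x : x \in nth [::] gs j -> star c x.
    move=> xg; have xw : x \in children J w.
      by rewrite -(perm_mem pgs); apply/flattenP; exists (nth [::] gs j).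
    exact: (star_children r01 E_eq xw).
  have /eqP sumg := allP ags _ jgs.
  rewrite (_ : flatten _ = nseq N None) //.
  have dN : d * N = sumn (map weight (nth [::] gs j)) by rewrite sumg.
  have {dN} NE : N = sumn [seq weight x %/ d | x <- nth [::] gs j].
    apply/eqP; rewrite -(eqn_pmul2l d0) dN; apply/eqP.
    elim: (nth [::] gs j) gstar => [|x s IH] gstar /=; first by rewrite muln0.
    rewrite mulnDr -IH; last by move=> y ys; apply: gstar; rewrite inE ys orbT.
    by rewrite [d * _]mulnC divnK // dstar //; apply: gstar; exact: mem_head.
  rewrite NE; elim: (nth [::] gs j) gstar => //= x s IH gstar.
  rewrite nseqD IH; last by move=> y ys; apply: gstar; rewrite inE ys orbT.
  by rewrite ifT //; apply/asboolP/gstar/mem_head.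
(* the same tree, regrouped so as to match [m ^ J]-ary words *)
pose Z : eqType := (seq 'I_m + nat)%type.
(* A unit stretched to [s] matches [s] words, a component twice its weight. Units among the children
   number at most the total star weight, so all children fit with room to spare into [2 * weight w]
   bins of capacity [N]. *)
pose lab2 (u : Z) : seq unit :=
  if u is inr s then nseq s tt else if u is inl w then nseq (2 * weight w) tt else [::].
have /choice[zg zgP] : forall w, exists gs : seq (seq Z), ~ star c w ->
    [/\ size gs = 2 * weight w,
    perm_eq (map (@forget _ _) (flatten gs)) (map Some (others w) ++ nseq (units w) None),
    all (fun g => sumn [seq size (lab2 x) | x <- g] == N) gs &
    all (fun x => if x is inr s then 0 < s <= N else true) (flatten gs)].
  move=> w; have [sw|sw] := pselect (star c w); first by exists [::].
  have w0 := weight_gt0 r S E w.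
  have wM := weightM w; have sB := stars_B w; have uge := units_ge w; have ule := units_le w.
  have hsum := sum_children w.
  have zsum : sumn [seq 2 * weight x | x <- others w] = 2 * sumn (map weight (others w)).
    by elim: (others w) => //= x s ->; rewrite mulnDr.
  have [||||||gs [h1 h2 h3 h4]] := @slack_packing _ (fun x => 2 * weight x) (2 * M)
      (2 * weight w) N (units w) (others w) => //.
  - by rewrite muln_gt0.
  - by apply/allP => x _; rewrite muln_gt0 weight_gt0 leq_mul2l weightM.
  - rewrite zsum; move: hsum sB uge ule; rewrite /B.
    set a := sumn _; set b := sumn _; set e := units w; nia.
  - by move: sB uge; rewrite /B; nia.
  - rewrite zsum; move: hsum sB uge ule; rewrite /B.
    set a := sumn _; set b := sumn _; set e := units w; nia.
  exists gs => _; split => //.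
  apply: sub_all h3 => g /eqP <-; apply/eqP; congr sumn; apply/eq_map => -[x|s] /=;
  by rewrite size_nseq.
(* A unit that has to match [s] words, [1 <= s <= N], splits into units       *)
(* matching [N] words or [1] word, which are exact copies of [N]-ary trees,   *)
(* and one unit that again has to match [s] words: the mismatch is pushed     *)
(* down a single branch.                                                      *)
pose gz (u : Z) : seq (seq Z) := match u with
  | inl w => zg w
  | inr s => nseq s.-1 [:: inr N] ++ [:: nseq (N - s) (inr 1) ++ [:: inr s]] end.
pose chZ u := flatten (gz u).
pose invZ (u : Z) := match u with inl w => ~ star c w | inr s => 0 < s <= N end.
have invS s x : 0 < s <= N -> x \in chZ (inr s) -> exists s', x = inr s' /\ 0 < s' <= N.
  move=> sN; rewrite /chZ flatten_cat mem_cat => /orP[|].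
    by move=> /flattenP[g /nseqP[-> _]]; rewrite inE => /eqP->; exists N; rewrite N0 leqnn.
  rewrite /= cats0 mem_cat inE => /orP[/nseqP[-> _]|/eqP->]; last by exists s.
  by exists 1.
have invP u : invZ u -> forall x, x \in chZ u -> invZ x.
  case: u => [w|s] /= hu x xu; last by have [s' [-> ?]] := invS s x hu xu.
  have [_ pz _ az] := zgP w hu; have := allP az x xu; case: x xu => // y yu _ /=.
  have : Some y \in map (@forget _ _) (flatten (zg w)) by apply/mapP; exists (inl y).
  rewrite (perm_mem pz) mem_cat => /orP[/mapP[y' + [->]]|/nseqP[]//].
  by rewrite mem_filter => /andP[/asboolPn].
have sizeS s : 0 < s <= N -> size (chZ (inr s)) = N.
  move=> sN; rewrite /chZ flatten_cat size_cat size_flatten /shape map_nseq sumn_nseq.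
  by rewrite /= cats0 size_cat size_nseq /=; lia.
have Z_to_1 w : ~ star c w ->
    path_equiv (tree_path (inr 0 : Z) chZ (inl w)) (forest_path None ch1 [:: Some w]).
  move=> nw; apply: (@regrouping_equiv _ _ _ _ _ _ (fun u => [:: forget u]) invZ) => // u hu.
  exists [:: chZ u]; split => //=; first by rewrite cats0.
  case=> // _ /=; rewrite (_ : flatten _ = map (@forget _ _) (chZ u)); last first.
    by elim: (chZ u) => //= x s ->.
  case: u hu => [v|s] /= hu.
    by have [_ pz _ _] := zgP v hu; rewrite (perm_trans pz) // perm_sym; exact: ch1E.
  rewrite (_ : map _ _ = nseq N None) // -(sizeS s hu).
  elim: (chZ (inr s)) (invS s ^~ hu) => //= x xs IH hx.
  rewrite IH; last by move=> y ys; apply: hx; rewrite inE ys orbT.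
  by have [s' [-> _]] := hx x (mem_head _ _).
have Z_to_2 u : invZ u -> path_equiv (tree_path (inr 0 : Z) chZ u)
    (forest_path tt (fun=> nseq N tt) (lab2 u)).
  move=> hu; apply: (@regrouping_equiv _ _ _ _ _ _ lab2 invZ) => // {hu} u hu.
  exists (gz u); split => //.
    case: u hu => [w|s] /= hu; first by have [-> _ _ _] := zgP w hu; rewrite size_nseq.
    by rewrite size_cat !size_nseq /=; lia.
  move=> j ju; apply: unit_seq_perm; rewrite size_nseq size_flatten /shape -map_comp.
  case: u hu ju => [w|s] /= hu; rewrite size_nseq => ju.
    by have [sg _ ag _] := zgP w hu; apply/eqP; apply: (allP ag); rewrite mem_nth // sg.
  rewrite nth_cat size_nseq; case: ifP => js.
    by rewrite nth_nseq js /= size_nseq addn0.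
  rewrite (_ : j - s.-1 = 0); last by lia.
  by rewrite /= map_cat sumn_cat map_nseq sumn_nseq /= size_nseq; lia.
have Z_to_unit s : 0 < s <= N -> path_equiv (tree_path (inr 0 : Z) chZ (inr s))
    (forest_path tt (fun=> nseq N tt) [:: tt]).
  move=> hs; apply: (@regrouping_equiv _ _ _ _ _ _ (fun=> [:: tt])
    (fun u => exists s', u = inr s' /\ 0 < s' <= N)); last by exists s.
  - by move=> _ [s' [-> hs']] x; exact: invS.
  move=> _ [s' [-> hs']]; exists [:: chZ (inr s')]; split => //=; first by rewrite cats0.
  case=> // _ /=; apply: unit_seq_perm; rewrite size_nseq -(sizeS s' hs').
  by elim: (chZ _) => //= x xs ->.
have ns0 := @not_star_nil _ _ _ r S E c.
have lab1_nil : lab1 [::] = [:: Some [::]] by rewrite /lab1; case: asboolP.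
have w1 : weight [::] = 1 by rewrite /weight comp_nil.
have N2 : 0 < 2 <= N by rewrite /= (leq_trans _ JN) // /J; lia.
rewrite lab1_nil in E_to_1.
(* The root, of weight 1, is matched with two [N]-ary trees. These are also matched with the tree at
   [inr 2], all of whose nodes have [N] children, hence with one [N]-ary tree. *)
apply: (path_equiv_trans E_to_1).
apply: (path_equiv_trans (path_equiv_sym (Z_to_1 _ ns0))).
apply: (path_equiv_trans (Z_to_2 (inl [::]) ns0)).
rewrite /= w1.
apply: (path_equiv_trans (path_equiv_sym (Z_to_2 (inr 2) N2))).
apply: (path_equiv_trans (Z_to_unit 2 N2)).
exact: forest_path1.
Qed.

End TreeEquivalence.

Theorem theorem3 (R : realType) (l n m : nat) (hn : (2 <= n)%N) (hm : (2 <= m)%N)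
    (G : set 'rV[R]_l) (hG : discrete_subgroup G)
    (GG : set (G -> G)) (hGG : finite_isometric_group GG)
    (ext : (G -> G) -> {linear 'rV[R]_l -> 'rV[R]_l})
    (hext : linear_isometric_extension GG ext)
    (g : 'I_m -> G -> G) (hg : forall i, GG (g i))
    (b : 'I_m -> 'rV[R]_l) (hb : forall i, G (b i))
    (S : 'I_m -> 'rV[R]_l -> 'rV[R]_l)
    (hS : forall i x, S i x = n%:R^-1 *: ext (g i) x + b i)
    (E : set 'rV[R]_l) (hE : self_similar_set S E)
    (hdisc : totally_disconnected E)
    (hover : ~ complete_overlaps S) :
  dust_class m n%:R^-1 (@subset_dist R l E) /\
  bilipschitz_equivalent (@subset_dist R l E)
    (@symbolic_dist R m n%:R^-1).
Proof.
split; first exact: (self_similar_dust_class hn hG hGG hext hg hb hS hE).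
have r01 := @ratio_lt1 R _ hn; have /andP[r0 r1] := r01.
have S_dist := self_similar_dist hext hg hS.
have E_eq := self_similar_eq hE.
have [c [c0 hc]] := component_diameter hn hG hGG hext hg hb hS hE hdisc.
have [M [M0 weightM]] := component_weight_bounded hn hG hGG hext hg hb hS hE hdisc hover.
have [cmax hcmax] := maximal_component weightM.
have [J [J0 equivJ]] := tree_equiv hm r01 S_dist E_eq M0 weightM hcmax.
have [E0 cE _] := hE.
have rJ : 0 < (n%:R^-1 : R) ^+ J < 1 by rewrite exprn_gt0 //= exprn_ilt1 ?ltW // -lt0n.
apply: (coded_bilipschitz rJ _ _ equivJ).
  exact: (component_coding r01 E_eq E0 cE J0 c0 hc).
exact: (symbolic_coding m r01 J0).
Qed.
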